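(* Let $n>1$ be an odd integer and let $M$ be either $(n+1)/2$ or $n-1$. Then, modulo $\Phi_n(q)(1-aq^n)(a-q^n)(b-q^n)$, \begin{align*} &\sum_{k=0}^{M}[4k-1]\frac{(aq^{-1},q^{-1}/a,q^{-1}/b,cq^{-1},dq^{-1},q^{-1};q^2)_k}{(q^{2}/a,aq^2,bq^2,q^2/c,q^{2}/d,q^2;q^2)_k}\bigg(\frac{bq^7}{cd}\bigg)^k\\ &\equiv[n]\Theta_q(a,b,n) \sum_{k=0}^{(n+1)/2}\frac{(aq^{-1},q^{-1}/a,q^{-1}/b,q^3/cd;q^2)_k}{(q^2,q^{-2}/b,q^2/c,q^2/d;q^2)_k}q^{2k}, \end{align*} where \begin{align*} \Theta_q(a,b,n)&=\frac{(b-q^n)(ab-1-a^2+aq^n)}{(a-b)(1-ab)}\frac{(bq)^{(n+1)/2}(q^{-2}/b;q^2)_{(n+1)/2}}{(bq^2;q^2)_{(n+1)/2}}\\ &\quad+\frac{(1-aq^n)(a-q^n)}{(a-b)(1-ab)}\frac{(b;q^2)_2(q^{-1};q^2)_{(n+1)/2}^2}{(q^{-1};q^2)_2(q^2/a,aq^{2};q^2)_{(n+1)/2}}. \end{align*}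
   Context: Here $q,a,b,c,d$ are indeterminates. The $q$-shifted factorial is $(x;q)_0=1$, $(x;q)_k=(1-x)(1-xq)\cdots(1-xq^{k-1})$ for $k\ge1$, and $(x_1,\dots,x_m;q)_k=(x_1;q)_k\cdots(x_m;q)_k$. The $q$-integer is $[m]=(1-q^m)/(1-q)$, and $\Phi_n(q)$ is the $n$-th cyclotomic polynomial in $q$. A congruence $A\equiv B$ modulo a polynomial $P$ between rational functions means that $A-B$ is a rational function whose numerator is divisible by $P$ and whose denominator is coprime to $P$. *)

(* Defs.v *)
From HB Require Import structures.
From mathcomp Require Import all_boot all_order all_algebra all_field.
From mathcomp Require Import fraction cyclotomic.
Import FracField.
From mathcomp.multinomials Require Import mpoly.
Set Implicit Arguments. Unset Strict Implicit. Unset Printing Implicit Defensive.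
Import Order.TTheory GRing.Theory Num.Theory.
Local Open Scope ring_scope.

Definition Poly := {mpoly rat[5]}.
Definition RF := {fraction Poly}.
Definition toRF (p : Poly) : RF := FracField.tofrac p.

Definition mq : Poly := 'X_(@inord 4 0).
Definition ma : Poly := 'X_(@inord 4 1).
Definition mb : Poly := 'X_(@inord 4 2).
Definition mc : Poly := 'X_(@inord 4 3).
Definition md : Poly := 'X_(@inord 4 4).

Definition q_ : RF := toRF mq.
Definition a_ : RF := toRF ma.
Definition b_ : RF := toRF mb.
Definition c_ : RF := toRF mc.
Definition d_ : RF := toRF md.

Definition PhiQ (n : nat) : Poly :=
  (map_poly (fun z : int => z%:~R : Poly) 'Phi_n).[mq].

Definition qpoch (x p : RF) (k : nat) : RF := \prod_(i < k) (1 - x * p ^+ i).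

Definition qint (q : RF) (m : int) : RF := (1 - q ^ m) / (1 - q).

Definition mdvd (p r : Poly) : Prop := exists s : Poly, r = s * p.
Definition mcoprime (D P : Poly) : Prop :=
  forall g : Poly, mdvd g D -> mdvd g P -> exists c : rat, c != 0 /\ g = c%:MP.

Definition cong_mod (A B : RF) (P : Poly) : Prop :=
  exists N D : Poly, D != 0 /\ mcoprime D P /\ mdvd P N /\ A - B = toRF N / toRF D.

Definition Theta (n : nat) : RF :=
  let q := q_ in let a := a_ in let b := b_ in let h := (n.+1)./2 in
  (b - q ^+ n) * (a * b - 1 - a ^+ 2 + a * q ^+ n) / ((a - b) * (1 - a * b))
    * ((b * q) ^+ h * qpoch (q^-2 / b) (q ^+ 2) h / qpoch (b * q ^+ 2) (q ^+ 2) h)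
  + (1 - a * q ^+ n) * (a - q ^+ n) / ((a - b) * (1 - a * b))
    * (qpoch b (q ^+ 2) 2 * (qpoch q^-1 (q ^+ 2) h) ^+ 2
       / (qpoch q^-1 (q ^+ 2) 2 * qpoch (q ^+ 2 / a) (q ^+ 2) h
          * qpoch (a * q ^+ 2) (q ^+ 2) h)).

(* Main.v *)
Require Import Defs.
From HB Require Import structures.
From mathcomp Require Import all_boot all_order all_algebra all_field.
From mathcomp Require Import fraction cyclotomic.
From mathcomp.multinomials Require Import mpoly.
From mathcomp Require Import ring zify.
Import Order.TTheory GRing.Theory Num.Theory.
Local Open Scope ring_scope.

(** The four factors of the modulus are pairwise non-associated primes of
    [Q[q,a,b,c,d]]: each one generates the kernel of a homomorphism to a field,
    namely [q := zeta_n], [a := q^-n], [a := q^n] and [b := q^n].  It is thus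
    enough to show that both sides are regular at these primes and have the same
    image under each of the four homomorphisms.

    The left-hand side is a very-well-poised series in base [q^2] with leading
    parameter [q^-1].  In all four cases it terminates at [(n+1)/2], and Watson's
    8phi7-to-4phi3 transformation writes it as a product times the sum on the
    right: the product vanishes for [q = zeta_n], and equals [n] Theta in the
    other cases.  Watson's transformation follows by expanding the factor
    [(B,C)_k / (al p/B, al p/C)_k] in the Newton basis [(p^-k, al p^k)_j]
    (q-Pfaff-Saalschutz) and summing over [k] first; both steps telescope. *)

Set Implicit Arguments. Unset Strict Implicit. Unset Printing Implicit Defensive.

Local Notation MPol := Defs.Poly.

(** * Watson's transformation *)

Section Watson.

Variables (K : fieldType) (p : K).

Definition poch (x : K) (k : nat) : K := \prod_(i < k) (1 - x * p ^+ i).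

Lemma poch0 x : poch x 0 = 1.
Proof. by rewrite /poch big_ord0. Qed.

Lemma pochS x k : poch x k.+1 = poch x k * (1 - x * p ^+ k).
Proof. by rewrite /poch big_ord_recr. Qed.

Lemma pochSl x k : poch x k.+1 = (1 - x) * poch (x * p) k.
Proof.
rewrite /poch big_ord_recl expr0 mulr1; congr (_ * _).
by apply: eq_bigr => i _; rewrite /= exprS mulrA.
Qed.

Lemma poch_neq0 x k : poch x k != 0 <-> forall i, (i < k)%N -> 1 - x * p ^+ i != 0.
Proof.
split=> [/prodf_neq0 h i ik|h]; first exact: (h (Ordinal ik)).
by apply/prodf_neq0 => i _; apply: h.
Qed.

Lemma poch_eq0 x k i : (i < k)%N -> x * p ^+ i = 1 -> poch x k = 0.
Proof.
move=> ik e; apply/eqP/prodf_eq0.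
by exists (Ordinal ik) => //=; rewrite e subrr.
Qed.

Lemma poch_neq0_le x j k : (j <= k)%N -> poch x k != 0 -> poch x j != 0.
Proof.
by move=> jk /poch_neq0 h; apply/poch_neq0 => i ij; apply: h; apply: leq_trans jk.
Qed.

Variables (al : K).
Hypotheses (p0 : p != 0) (al0 : al != 0).

(** A Newton basis in the variable [P^-1 + al * P]: the factor with index [j] is [1 + al * p ^+ (2 *
    j) - p ^+ j * (P^-1 + al * P)], and the nodes are [P = p ^+ k]. *)
Definition newton (P : K) (j : nat) : K := poch P^-1 j * poch (al * P) j.

Lemma newtonS P j : newton P j.+1 =
  newton P j * (1 - P^-1 * p ^+ j) * (1 - al * P * p ^+ j).
Proof. by rewrite /newton !pochS; ring. Qed.

Lemma newton_eq0 k j : (k < j)%N -> newton (p ^+ k) j = 0.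
Proof.
by move=> kj; rewrite /newton (poch_eq0 kj) ?mul0r // mulVf // expf_neq0.
Qed.

(** * The balanced terminating 3phi2 sum *)

Section Saalschutz.

Variables (B C : K).
Hypotheses (B0 : B != 0) (C0 : C != 0).

(** Multiplied by [newton (p ^+ k) j], these are the summands of the balanced 3phi2 with upper
    parameters p^-k, al p^k, al p/(BC) and lower parameters al p/B, al p/C. *)
Definition saal_coef (j : nat) : K :=
  poch (al * p / (B * C)) j
  / (poch p j * poch (al * p / B) j * poch (al * p / C) j) * p ^+ j.

(** Links the Saalschutz sums at [P] and [P * p]. The closed form contains [poch P^-1 m], which
    vanishes at [P = p ^+ k] for [k < m] and so leaves a recurrence in [k]. *)
Lemma saal_telescope (P : K) (m : nat) : P != 0 ->
    poch p m != 0 -> poch (al * p / B) m != 0 -> poch (al * p / C) m != 0 ->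
  \sum_(j < m.+1) saal_coef j *
     ((1 - al * p / B * P) * (1 - al * p / C * P) * newton (P * p) j
      - al * p / (B * C) * (1 - B * P) * (1 - C * P) * newton P j)
  = (1 - al * P ^+ 2 * p) * (saal_coef m / p ^+ m) * (1 - al * p / (B * C) * p ^+ m)
    * poch P^-1 m * poch (al * (P * p)) m.
Proof.
move=> P0; elim: m => [|m IH] hp hB hC.
  rewrite big_ord1 /saal_coef /newton !poch0.
  by rewrite /= !expr0; field; rewrite C0 B0 oner_neq0.
have [hp' hB' hC'] : [/\ poch p m != 0, poch (al * p / B) m != 0
    & poch (al * p / C) m != 0].
  by split; apply: poch_neq0_le (leqnSn m) _.
rewrite big_ord_recr IH //= /saal_coef /newton.
(* With these first factors split off, both Newton values become multiples of [poch P^-1 m] and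
   [poch (al * (P * p)) m]. *)
rewrite [poch (P * p)^-1 _]pochSl [poch (al * P) _]pochSl.
have -> : (P * p)^-1 * p = P^-1 by field; rewrite P0 p0.
have -> : al * P * p = al * (P * p) by ring.
move: hp hB hC; rewrite !pochS !exprS.
rewrite !mulf_eq0 !negb_or => /andP[_ hp] /andP[_ hB] /andP[_ hC].
move: (poch P^-1 m) (poch (al * (P * p)) m) (poch (al * p / (B * C)) m) => X Y Z.
move: (poch p m) hp' (poch (al * p / B) m) hB' (poch (al * p / C) m) hC'.
have Q0 : p ^+ m != 0 by rewrite expf_neq0.
move: (p ^+ m) Q0 hp hB hC => Q Q0 hp hB hC U hU V hV W hW.
have hB2 : B - al * p * Q != 0.
  have -> : B - al * p * Q = B * (1 - al * p / B * Q) by field.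
  by rewrite mulf_neq0.
have hC2 : C - al * p * Q != 0.
  have -> : C - al * p * Q = C * (1 - al * p / C * Q) by field.
  by rewrite mulf_neq0.
by field; rewrite ?Q0 ?hU ?hV ?hW ?P0 ?oner_neq0 ?p0 ?C0 ?B0 ?hp ?hB2 ?hC2 //.
Qed.

(* The q-Pfaff-Saalschutz sum, read as the Newton expansion of a well-poised
   ratio with respect to [newton (p ^+ k)]. *)
Lemma wp_saalschutz N k : (k <= N)%N ->
    poch p N != 0 -> poch (al * p / B) N != 0 -> poch (al * p / C) N != 0 ->
  \sum_(j < N.+1) saal_coef j * newton (p ^+ k) j
  = poch B k * poch C k / (poch (al * p / B) k * poch (al * p / C) k)
    * (al * p / (B * C)) ^+ k.
Proof.
move=> kN hp hB hC; elim: k kN => [_|k IH kN].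
  rewrite big_ord_recl big1 => [|i _]; last first.
    by rewrite newton_eq0 ?mulr0.
  by rewrite /saal_coef /newton !poch0 !expr0 !mulr1 invr1 addr0.
have /IH{}IH : (k <= N)%N by apply: ltnW.
have P0 : p ^+ k != 0 by rewrite expf_neq0.
have := saal_telescope P0 hp hB hC.
rewrite (poch_eq0 kN) ?mulVf // mulr0 mul0r.
under eq_bigr => j _ do rewrite mulrBr.
have hBk : 1 - al * p / B * p ^+ k != 0 by move/poch_neq0: hB; apply.
have hCk : 1 - al * p / C * p ^+ k != 0 by move/poch_neq0: hC; apply.
rewrite sumrB -exprSr.
under eq_bigr => j _ do rewrite mulrCA.
rewrite -mulr_sumr => /eqP; rewrite subr_eq0 => /eqP.
under [RHS]eq_bigr => j _ do rewrite mulrCA.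
rewrite -mulr_sumr IH => e.
apply: (mulfI (mulf_neq0 hBk hCk)); rewrite {}e !pochS !exprS.
have hBj : poch (al * p / B) k != 0 by apply: poch_neq0_le hB; apply: ltnW.
have hCj : poch (al * p / C) k != 0 by apply: poch_neq0_le hC; apply: ltnW.
move: (poch (al * p / B) k) hBj (poch (al * p / C) k) hCj => U hU V hV.
move: (1 - al * p / B * p ^+ k) hBk (1 - al * p / C * p ^+ k) hCk => S hS T hT.
by move: ((_ / _) ^+ k) => Z; field; rewrite hU hV hS hT B0 C0.
Qed.

End Saalschutz.

(** * Moments of the very-well-poised 6phi5 summand *)

Section Moments.

Variables (D E F : K).
Hypotheses (D0 : D != 0) (E0 : E != 0) (F0 : F != 0).

(** The 6phi5 summand with argument al p/(DEF), without its very-well-poised factor; [wp_term]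
    restores that factor, not divided by [1 - al]. *)
Definition wp_ratio (k : nat) : K :=
  poch al k * poch D k * poch E k * poch F k
  / (poch p k * poch (al * p / D) k * poch (al * p / E) k * poch (al * p / F) k)
  * (al * p / (D * E * F)) ^+ k.

Definition wp_term (k : nat) : K := (1 - al * p ^+ (2 * k)) * wp_ratio k.

(** By [newtonS] the bracket encodes a first-order recurrence of the moments in [j]. The right-hand
    side is the antidifference in [m], and it vanishes where the series terminates. *)
Lemma wp_telescope (j m : nat) :
    poch p m != 0 -> poch (al * p / D) m != 0 -> poch (al * p / E) m != 0 ->
    poch (al * p / F) m != 0 ->
  \sum_(k < m.+1) wp_term k * newton (p ^+ k) j *
    ((1 - D * E * F / al * p ^+ j) * (1 - (p ^+ k)^-1 * p ^+ j)
       * (1 - al * p ^+ k * p ^+ j)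
     - (1 - D * p ^+ j) * (1 - E * p ^+ j) * (1 - F * p ^+ j))
  = - p ^+ j / p ^+ m * wp_ratio m * newton (p ^+ m) j
    * (1 - al * p ^+ m * p ^+ j)
    * (1 - D * p ^+ m) * (1 - E * p ^+ m) * (1 - F * p ^+ m).
Proof.
elim: m => [|m IH] hp hD hE hF.
  rewrite big_ord1 /=.
  case: j => [|j].
    rewrite /wp_term /wp_ratio /newton !poch0 muln0 !expr0.
    by field; rewrite al0 oner_neq0.
  by rewrite newton_eq0 // !(mulr0, mul0r).
have [hp' hD' hE' hF'] : [/\ poch p m != 0, poch (al * p / D) m != 0,
    poch (al * p / E) m != 0 & poch (al * p / F) m != 0].
  by split; apply: poch_neq0_le (leqnSn m) _.
rewrite big_ord_recr IH //= {IH}.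
have P0 : p ^+ m != 0 by rewrite expf_neq0.
(* [newton] at consecutive nodes, cross-multiplied to avoid dividing by
   [1 - al * p ^+ m], which may vanish. *)
have eT : newton (p ^+ m.+1) j * (1 - p ^+ j / p ^+ m.+1) * (1 - al * p ^+ m)
    = newton (p ^+ m) j * (1 - (p ^+ m.+1)^-1) * (1 - al * p ^+ m * p ^+ j).
  have e1 := pochS (p ^+ m.+1)^-1 j; have e2 := pochS (al * p ^+ m) j.
  rewrite pochSl in e1; rewrite pochSl in e2.
  have e3 : (p ^+ m.+1)^-1 * p = (p ^+ m)^-1 by rewrite exprS; field; rewrite P0 p0.
  rewrite e3 in e1; rewrite -mulrA -exprSr in e2.
  rewrite /newton; transitivity ((poch (p ^+ m.+1)^-1 j * (1 - (p ^+ m.+1)^-1 * p ^+ j)) *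
    ((1 - al * p ^+ m) * poch (al * p ^+ m.+1) j)); first by ring.
  by rewrite -e1 e2; ring.
rewrite /wp_term /wp_ratio mul2n -addnn exprD.
move: hp hD hE hF; rewrite !pochS !exprS.
rewrite !mulf_eq0 !negb_or => /andP[_ hp] /andP[_ hD] /andP[_ hE] /andP[_ hF].
move: eT; rewrite !exprS.
move: (newton (p ^+ m) j) (newton (p * p ^+ m) j) => T T'.
move: (poch al m) (poch D m) (poch E m) (poch F m) => XA XD XE XF.
move: (poch p m) hp' (poch (al * p / D) m) hD' (poch (al * p / E) m) hE'
  (poch (al * p / F) m) hF' => U hU V hV W hW Y hY.
move: ((al * p / (D * E * F)) ^+ m) => Z.
move: (p ^+ m) P0 hp hD hE hF => P P0 hp hD hE hF.
move: (p ^+ j) => J.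
have c2 (x : K) : x != 0 -> 1 - al * p / x * P != 0 -> x - al * p * P != 0.
  move=> x0 h; have -> : x - al * p * P = x * (1 - al * p / x * P) by field.
  by rewrite mulf_neq0.
move: (c2 _ D0 hD) (c2 _ E0 hE) (c2 _ F0 hF) => hD2 hE2 hF2 eT.
have hp3 : p * P - 1 != 0 by rewrite -oppr_eq0 opprB.
pose R := XA * XD * XE * XF / (U * V * W * Y) * Z * (1 - D * P) * (1 - E * P)
  * (1 - F * P) / P * J.
set L1 := (X in X + _ = _).
have -> : L1 = - R * T * (1 - al * P * J) by rewrite /L1 /R; field; rewrite P0 hU hV hW hY.
(* [eT] trades the value [T] at node [m] for [T'] at node [m.+1], so that every term becomes a
   multiple of [T']. The division by [1 - (p * P)^-1] is justified by [hp3]. *)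
have -> : - R * T * (1 - al * P * J)
    = - R / (1 - (p * P)^-1) * (T * (1 - (p * P)^-1) * (1 - al * P * J)).
  by field; rewrite p0 P0 hp3.
rewrite -eT /R {L1 R}.
by field; rewrite ?hU ?hV ?hW ?hY ?P0 ?p0 ?al0 ?D0 ?E0 ?F0 ?hD2 ?hE2 ?hF2 ?hp ?hp3 ?oner_neq0.
Qed.

(* The moments obey a first-order recurrence in [j], which is solved from
   [j = N], where a single term survives. *)
Definition wp_moment (N j : nat) : K :=
  \sum_(k < N.+1) wp_term k * newton (p ^+ k) j.

Lemma wp_momentS N j :
    poch p N != 0 -> poch (al * p / D) N != 0 -> poch (al * p / E) N != 0 ->
    poch (al * p / F) N != 0 ->
    [\/ al * p ^+ N = 1, D * p ^+ N = 1, E * p ^+ N = 1 | F * p ^+ N = 1] ->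
  (1 - D * E * F / al * p ^+ j) * wp_moment N j.+1
  = (1 - D * p ^+ j) * (1 - E * p ^+ j) * (1 - F * p ^+ j) * wp_moment N j.
Proof.
move=> hp hD hE hF hN.
have := wp_telescope j hp hD hE hF.
have -> : - p ^+ j / p ^+ N * wp_ratio N * newton (p ^+ N) j
    * (1 - al * p ^+ N * p ^+ j)
    * (1 - D * p ^+ N) * (1 - E * p ^+ N) * (1 - F * p ^+ N) = 0.
  case: hN => e; rewrite e; try by rewrite subrr ?mulr0 ?mul0r.
  (* The case [al * p ^+ N = 1]: at [j = 0] the factor [1 - al * p ^+ N * p ^+ j] is zero; at
     positive [j] the Newton value contains [poch 1 j], which is zero. *)
  case: j => [|j]; first by rewrite mulr1 subrr !(mulr0, mul0r).
  rewrite [newton _ _](_ : _ = 0) ?(mulr0, mul0r) //.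
  by rewrite /newton e (@poch_eq0 1 j.+1 0) ?mulr0 ?mulr1.
move=> e; apply/eqP; rewrite -subr_eq0 -[X in _ == X]e /wp_moment !mulr_sumr -sumrB.
by apply/eqP; apply: eq_bigr => k _; rewrite newtonS; ring.
Qed.

Lemma wp_moment_top N : wp_moment N N = wp_term N * newton (p ^+ N) N.
Proof.
rewrite /wp_moment big_ord_recr /= big1 ?add0r // => i _.
by rewrite newton_eq0 ?mulr0 //=.
Qed.

Lemma wp_moment_ratio N j :
    poch p N != 0 -> poch (al * p / D) N != 0 -> poch (al * p / E) N != 0 ->
    poch (al * p / F) N != 0 ->
    [\/ al * p ^+ N = 1, D * p ^+ N = 1, E * p ^+ N = 1 | F * p ^+ N = 1] ->
  poch (D * E * F / al) j * wp_moment N j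
  = poch D j * poch E j * poch F j * wp_moment N 0.
Proof.
move=> hp hD hE hF hN; elim: j => [|j IH]; first by rewrite !poch0 !mul1r.
rewrite pochS -mulrA (wp_momentS _ hp hD hE hF hN) mulrCA IH !pochS; ring.
Qed.

(** The terminating 6phi5 sum, in one formula for all four ways to terminate. [wp_moment_ratio] at
    [j = N] compares it with the single-term top moment, whose factors [poch D N], [poch E N],
    [poch F N] cancel. *)
Lemma wp_moment0 N :
    poch p N != 0 -> poch (al * p / D) N != 0 -> poch (al * p / E) N != 0 ->
    poch (al * p / F) N != 0 ->
    poch D N != 0 -> poch E N != 0 -> poch F N != 0 ->
    [\/ al * p ^+ N = 1, D * p ^+ N = 1, E * p ^+ N = 1 | F * p ^+ N = 1] ->
  wp_moment N 0 = (1 - al * p ^+ (2 * N)) * poch al N * poch (al * p ^+ N) N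
    * poch (p ^+ N)^-1 N * poch (D * E * F / al) N * (al * p / (D * E * F)) ^+ N
    / (poch p N * poch (al * p / D) N * poch (al * p / E) N * poch (al * p / F) N).
Proof.
move=> hp hD hE hF h1 h2 h3 hN; have := wp_moment_ratio N hp hD hE hF hN.
rewrite wp_moment_top /wp_term /wp_ratio /newton => e.
apply: (mulfI (mulf_neq0 (mulf_neq0 h1 h2) h3)); rewrite -{}e.
move: (poch p N) hp (poch (al * p / D) N) hD (poch (al * p / E) N) hE
  (poch (al * p / F) N) hF => U hU V hV W hW Y hY.
by field; rewrite hU hV hW hY.
Qed.

End Moments.

Lemma wp_expansion (B C D E F : K) (N : nat) :
    B != 0 -> C != 0 ->
    poch p N != 0 -> poch (al * p / B) N != 0 -> poch (al * p / C) N != 0 ->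
  \sum_(k < N.+1) wp_term D E F k
     * (poch B k * poch C k / (poch (al * p / B) k * poch (al * p / C) k)
        * (al * p / (B * C)) ^+ k)
  = \sum_(j < N.+1) saal_coef B C j * wp_moment D E F N j.
Proof.
move=> B0 C0 hp hB hC.
under eq_bigr => k _ do
  rewrite -(wp_saalschutz B0 C0 (ltn_ord k : (k <= N)%N) hp hB hC) mulr_sumr.
rewrite exchange_big /=; apply: eq_bigr => j _.
by rewrite mulr_sumr; apply: eq_bigr => k _; rewrite mulrCA.
Qed.

(** All moments are multiples of the one of order 0, which factors out of the sum over [j]; it is
    the product in Watson's formula, evaluated by [wp_moment0]. *)
Lemma wp_transformation (B C D E F : K) (N : nat) :
    B != 0 -> C != 0 -> D != 0 -> E != 0 -> F != 0 ->
    poch p N != 0 -> poch (al * p / B) N != 0 -> poch (al * p / C) N != 0 ->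
    poch (al * p / D) N != 0 -> poch (al * p / E) N != 0 ->
    poch (al * p / F) N != 0 -> poch (D * E * F / al) N != 0 ->
    [\/ al * p ^+ N = 1, D * p ^+ N = 1, E * p ^+ N = 1 | F * p ^+ N = 1] ->
  \sum_(k < N.+1) wp_term D E F k
     * (poch B k * poch C k / (poch (al * p / B) k * poch (al * p / C) k)
        * (al * p / (B * C)) ^+ k)
  = wp_moment D E F N 0 * \sum_(j < N.+1) saal_coef B C j
      * (poch D j * poch E j * poch F j / poch (D * E * F / al) j).
Proof.
move=> B0 C0 D0 E0 F0 hp hB hC hD hE hF hu hN.
rewrite wp_expansion // mulr_sumr; apply: eq_bigr => j _.
have hj : poch (D * E * F / al) j != 0 by apply: poch_neq0_le hu; rewrite -ltnS.
have e := wp_moment_ratio D0 E0 F0 j hp hD hE hF hN.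
apply: (mulfI hj); rewrite mulrCA e.
by move: (poch _ j) hj => u hu'; field.
Qed.

(** The hypothesis makes x p^i and y p^(k-1-i) inverse to each other, and 1 - t = -t (1 - 1/t). *)
Lemma poch_rev (x y : K) k : x * y * p ^+ k = p ->
  poch x k = \prod_(i < k) - (x * p ^+ i) * poch y k.
Proof.
move=> e; rewrite /poch [X in _ = _ * X](reindex_inj rev_ord_inj) -big_split /=.
apply: eq_bigr => i _.
have {}e : x * p ^+ i * (y * p ^+ (k - i.+1)) = 1.
  apply: (mulIf p0); rewrite mul1r -[RHS]e.
  have -> : p ^+ k = p ^+ (k - i.+1) * p ^+ i.+1 by rewrite -exprD subnK.
  by rewrite exprS; ring.
by rewrite mulrBr mulr1 mulNr e; ring.
Qed.

Lemma poch_revr (x y : K) k : x * y * p ^+ k = p ->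
  poch x k = \prod_(i < k) - (y * p ^+ i)^-1 * poch y k.
Proof.
move=> e; rewrite (poch_rev e); congr (_ * _).
rewrite (reindex_inj rev_ord_inj) /=; apply: eq_bigr => i _; congr (- _).
have {}e : x * p ^+ (k - i.+1) * (y * p ^+ i) = 1.
  apply: (mulIf p0); rewrite mul1r -[RHS]e.
  have -> : p ^+ k = p ^+ (k - i.+1) * p ^+ i.+1 by rewrite -exprD subnK.
  by rewrite exprS; ring.
have h : y * p ^+ i != 0.
  by apply/eqP => h; move/eqP: e; rewrite h mulr0 eq_sym oner_eq0.
by apply: (mulIf h); rewrite e mulVf.
Qed.

End Watson.

(** * The two sides over a field *)

Section Sides.

Variables (K : fieldType) (q a b c d : K).

(** Stated over any field, so that one expression serves for the rational functions and for their
    four specializations. *)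
Definition lhs_term (k : nat) : K :=
  (1 - q ^ ((4 * k)%:Z - 1)) / (1 - q)
  * (poch (q ^+ 2) (a / q) k * poch (q ^+ 2) (q^-1 / a) k
     * poch (q ^+ 2) (q^-1 / b) k * poch (q ^+ 2) (c / q) k
     * poch (q ^+ 2) (d / q) k * poch (q ^+ 2) q^-1 k)
  / (poch (q ^+ 2) (q ^+ 2 / a) k * poch (q ^+ 2) (a * q ^+ 2) k
     * poch (q ^+ 2) (b * q ^+ 2) k * poch (q ^+ 2) (q ^+ 2 / c) k
     * poch (q ^+ 2) (q ^+ 2 / d) k * poch (q ^+ 2) (q ^+ 2) k)
  * (b * q ^+ 7 / (c * d)) ^+ k.

Definition rhs_term (k : nat) : K :=
  (poch (q ^+ 2) (a / q) k * poch (q ^+ 2) (q^-1 / a) k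
   * poch (q ^+ 2) (q^-1 / b) k * poch (q ^+ 2) (q ^+ 3 / (c * d)) k)
  / (poch (q ^+ 2) (q ^+ 2) k * poch (q ^+ 2) (q^-2 / b) k
     * poch (q ^+ 2) (q ^+ 2 / c) k * poch (q ^+ 2) (q ^+ 2 / d) k)
  * q ^+ (2 * k).

Definition theta (n : nat) : K :=
  let h := (n.+1)./2 in
  (b - q ^+ n) * (a * b - 1 - a ^+ 2 + a * q ^+ n) / ((a - b) * (1 - a * b))
    * ((b * q) ^+ h * poch (q ^+ 2) (q^-2 / b) h / poch (q ^+ 2) (b * q ^+ 2) h)
  + (1 - a * q ^+ n) * (a - q ^+ n) / ((a - b) * (1 - a * b))
    * (poch (q ^+ 2) b 2 * (poch (q ^+ 2) q^-1 h) ^+ 2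
       / (poch (q ^+ 2) q^-1 2 * poch (q ^+ 2) (q ^+ 2 / a) h
          * poch (q ^+ 2) (a * q ^+ 2) h)).

(** Ensures that the denominators of both sides and of [theta] are nonzero. The symbol of q^-2/b
    stops at (n+1)/2 because it is absent from the left-hand side. *)
Record nondegenerate (n M : nat) : Prop := Nondegenerate {
  nd_q : q != 0; nd_a : a != 0; nd_b : b != 0; nd_c : c != 0; nd_d : d != 0;
  nd_q1 : 1 - q != 0; nd_ab : a - b != 0; nd_1ab : 1 - a * b != 0;
  nd_Va : poch (q ^+ 2) (q ^+ 2 / a) M != 0;
  nd_ma : poch (q ^+ 2) (a * q ^+ 2) M != 0;
  nd_mb : poch (q ^+ 2) (b * q ^+ 2) M != 0;
  nd_Vc : poch (q ^+ 2) (q ^+ 2 / c) M != 0;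
  nd_Vd : poch (q ^+ 2) (q ^+ 2 / d) M != 0;
  nd_qq : poch (q ^+ 2) (q ^+ 2) M != 0;
  nd_Vb : poch (q ^+ 2) (q^-2 / b) (n.+1)./2 != 0 }.

Variables (n M : nat).
Local Notation N := (n.+1)./2.
Hypotheses (n1 : (1 < n)%N) (oddn : odd n) (NM : (N <= M)%N).
Hypothesis nd : nondegenerate n M.
Let q0 := nd_q nd.
Let a0 := nd_a nd.
Let b0 := nd_b nd.
Let c0 := nd_c nd.
Let d0 := nd_d nd.

Let nE : n.+1 = (2 * N)%N.
Proof. by rewrite mul2n -[LHS]odd_double_half /= oddn. Qed.

Let p0 : q ^+ 2 != 0. Proof. by rewrite expf_neq0. Qed.
Let al0 : q^-1 != 0. Proof. by rewrite invr_neq0. Qed.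

(** Translates termination at index [N] in base q^2 into conditions on q^n. *)
Let alN : q^-1 * (q ^+ 2) ^+ N = q ^+ n.
Proof. by rewrite -exprM -nE exprS mulKf. Qed.

(** The parameters [c / q], [d / q] form the Newton-expanded pair, so that al p/(BC) = q^3/(cd) and
    DEF/al = q^-2/b, as the right-hand sum requires. *)
Lemma lhs_termE k : lhs_term k = (1 - q)^-1 *
  (wp_term (q ^+ 2) q^-1 (a / q) (q^-1 / a) (q^-1 / b) k
     * (poch (q ^+ 2) (c / q) k * poch (q ^+ 2) (d / q) k
        / (poch (q ^+ 2) (q^-1 * q ^+ 2 / (c / q)) k
           * poch (q ^+ 2) (q^-1 * q ^+ 2 / (d / q)) k)
        * (q^-1 * q ^+ 2 / (c / q * (d / q))) ^+ k)).
Proof.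
rewrite /lhs_term /wp_term /wp_ratio.
have -> : q^-1 * q ^+ 2 / (c / q) = q ^+ 2 / c by field; rewrite q0 c0 ?oner_neq0.
have -> : q^-1 * q ^+ 2 / (d / q) = q ^+ 2 / d by field; rewrite q0 d0 ?oner_neq0.
have -> : q^-1 * q ^+ 2 / (a / q) = q ^+ 2 / a by field; rewrite q0 a0 ?oner_neq0.
have -> : q^-1 * q ^+ 2 / (q^-1 / a) = a * q ^+ 2 by field; rewrite q0 a0 ?oner_neq0.
have -> : q^-1 * q ^+ 2 / (q^-1 / b) = b * q ^+ 2 by field; rewrite q0 b0 ?oner_neq0.
have -> : q ^ ((4 * k)%:Z - 1) = q^-1 * (q ^+ 2) ^+ (2 * k).
  by rewrite expfzDr // exprN1 mulrC -exprM mulnA.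
have -> : (b * q ^+ 7 / (c * d)) ^+ k = (q^-1 * q ^+ 2 / (a / q * (q^-1 / a) * (q^-1 / b))) ^+ k
   * (q^-1 * q ^+ 2 / (c / q * (d / q))) ^+ k.
  by rewrite -exprMn; congr (_ ^+ _); field; rewrite q0 a0 b0 c0 d0 ?oner_neq0.
rewrite !invfM.
move: (_ ^+ k) (_ ^+ k) (1 - q)^-1 => z1 z2 z3.
ring.
Qed.

Lemma rhs_termE k : rhs_term k = saal_coef (q ^+ 2) q^-1 (c / q) (d / q) k
  * (poch (q ^+ 2) (a / q) k * poch (q ^+ 2) (q^-1 / a) k * poch (q ^+ 2) (q^-1 / b) k
     / poch (q ^+ 2) (a / q * (q^-1 / a) * (q^-1 / b) / q^-1) k).
Proof.
rewrite /rhs_term /saal_coef.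
have -> : q^-1 * q ^+ 2 / (c / q) = q ^+ 2 / c by field; rewrite q0 c0 ?oner_neq0.
have -> : q^-1 * q ^+ 2 / (d / q) = q ^+ 2 / d by field; rewrite q0 d0 ?oner_neq0.
have -> : q^-1 * q ^+ 2 / (c / q * (d / q)) = q ^+ 3 / (c * d) by field; rewrite q0 c0 d0 ?oner_neq0.
have -> : a / q * (q^-1 / a) * (q^-1 / b) / q^-1 = q^-2 / b.
  by field; rewrite q0 a0 b0 ?oner_neq0.
by rewrite exprM !invfM; ring.
Qed.

Let le_nz x : poch (q ^+ 2) x M != 0 -> poch (q ^+ 2) x N != 0.
Proof. exact: poch_neq0_le. Qed.

Lemma lhs_sum :
    poch (q ^+ 2) (a / q) N != 0 -> poch (q ^+ 2) (q^-1 / a) N != 0 ->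
    poch (q ^+ 2) (q^-1 / b) N != 0 ->
    [\/ q ^+ n = 1, a * q ^+ n = 1, q ^+ n / a = 1 | q ^+ n / b = 1] ->
  \sum_(0 <= k < M.+1) lhs_term k = (1 - q)^-1
    * ((1 - q ^+ n * q ^+ n.+1) * poch (q ^+ 2) q^-1 N * poch (q ^+ 2) (q ^+ n) N
       * poch (q ^+ 2) (q ^+ n.+1)^-1 N * poch (q ^+ 2) (q^-2 / b) N * (b * q ^+ 4) ^+ N
       / (poch (q ^+ 2) (q ^+ 2) N * poch (q ^+ 2) (q ^+ 2 / a) N
          * poch (q ^+ 2) (a * q ^+ 2) N * poch (q ^+ 2) (b * q ^+ 2) N))
    * \sum_(0 <= k < N.+1) rhs_term k.
Proof.
move=> h1 h2 h3 hN.
have e1 : q^-1 * q ^+ 2 / (c / q) = q ^+ 2 / c by field; rewrite q0 c0 ?oner_neq0.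
have e2 : q^-1 * q ^+ 2 / (d / q) = q ^+ 2 / d by field; rewrite q0 d0 ?oner_neq0.
have e3 : q^-1 * q ^+ 2 / (a / q) = q ^+ 2 / a by field; rewrite q0 a0 ?oner_neq0.
have e4 : q^-1 * q ^+ 2 / (q^-1 / a) = a * q ^+ 2 by field; rewrite q0 a0 ?oner_neq0.
have e5 : q^-1 * q ^+ 2 / (q^-1 / b) = b * q ^+ 2 by field; rewrite q0 b0 ?oner_neq0.
have e6 : a / q * (q^-1 / a) * (q^-1 / b) / q^-1 = q^-2 / b.
  by field; rewrite q0 a0 b0 ?oner_neq0.
have e7 : q^-1 * q ^+ 2 / (a / q * (q^-1 / a) * (q^-1 / b)) = b * q ^+ 4.
  by field; rewrite q0 a0 b0 ?oner_neq0.
have hN' : [\/ q^-1 * (q ^+ 2) ^+ N = 1, a / q * (q ^+ 2) ^+ N = 1,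
    q^-1 / a * (q ^+ 2) ^+ N = 1 | q^-1 / b * (q ^+ 2) ^+ N = 1].
  by case: hN => e; [apply: Or41|apply: Or42|apply: Or43|apply: Or44];
    rewrite -[RHS]e -?alN; ring.
(* For [k > N] one of the numerator symbols contains its factor of index [N], which [hN'] makes
   zero. *)
rewrite [LHS](_ : _ = \sum_(0 <= k < N.+1) lhs_term k); last first.
  rewrite (big_cat_nat (leq0n N.+1)) //= [X in _ + X]big_nat_cond.
  rewrite [X in _ + X]big1 ?addr0 // => k /andP[/andP[Nk _] _].
  rewrite lhs_termE /wp_term /wp_ratio.
  by case: hN' => e; rewrite (poch_eq0 Nk e) !(mul0r, mulr0).
rewrite !big_mkord; under eq_bigr => k _ do rewrite lhs_termE.
rewrite -mulr_sumr -[RHS]mulrA; congr (_ * _).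
have nVa := le_nz (nd_Va nd); have nma := le_nz (nd_ma nd).
have nmb := le_nz (nd_mb nd); have nVc := le_nz (nd_Vc nd).
have nVd := le_nz (nd_Vd nd); have nqq := le_nz (nd_qq nd).
have nVb := nd_Vb nd.
rewrite (@wp_transformation _ (q ^+ 2) q^-1 p0 al0 (c / q) (d / q) (a / q) (q^-1 / a)
  (q^-1 / b) N) ?e1 ?e2 ?e3 ?e4 ?e5 ?e6 ?mulf_neq0 ?invr_neq0 //.
under [in RHS]eq_bigr => k _ do rewrite rhs_termE e6.
congr (_ * _).
rewrite wp_moment0 ?e3 ?e4 ?e5 ?e6 ?e7 ?mulf_neq0 ?invr_neq0 //.
have -> : q^-1 * (q ^+ 2) ^+ (2 * N) = q ^+ n * q ^+ n.+1.
  by rewrite mul2n -addnn exprD mulrA alN -exprM -nE.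
by rewrite alN -exprM -nE.
Qed.

Hypotheses (nzD : poch (q ^+ 2) (a / q) N != 0)
  (nzE : poch (q ^+ 2) (q^-1 / a) N != 0) (nzF : poch (q ^+ 2) (q^-1 / b) N != 0).

(** The prefactor contains (q^n;q^2)_N, whose first factor is now zero. *)
Lemma lhs_sum_root_of_unity : q ^+ n = 1 -> \sum_(0 <= k < M.+1) lhs_term k = 0.
Proof.
move=> e; rewrite lhs_sum //; last exact: Or41.
rewrite e (@poch_eq0 _ _ 1 _ 0) ?mul1r ?expr0 ?(mulr0, mul0r) //.
by rewrite half_gt0; apply: ltnW.
Qed.

Let exprN_prod (x : K) : x ^+ N = \prod_(i < N) x.
Proof. by rewrite prodr_const card_ord. Qed.

(** Both sides are (q^n;q^2)_{N+1}, split at its last and at its first factor. *)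
Let shift_qn : (1 - q ^+ n * q ^+ n.+1) * poch (q ^+ 2) (q ^+ n) N
  = (1 - q ^+ n) * poch (q ^+ 2) (q ^+ n * q ^+ 2) N.
Proof. by rewrite -pochSl pochS mulrC -exprM -nE. Qed.

Let rev_top : poch (q ^+ 2) (q ^+ n.+1)^-1 N
  = \prod_(i < N) - (q ^+ 2 * (q ^+ 2) ^+ i)^-1 * poch (q ^+ 2) (q ^+ 2) N.
Proof.
by apply: poch_revr => //; rewrite -exprM -nE mulrC mulrA mulfV ?mul1r ?expf_neq0.
Qed.

(** Reversal turns (q^(-n-1))_N into (q^2)_N and (q^(2-n))_N into (q^-1)_N. The resulting monomials
    differ by q^(-3N), which reduces (b q^4)^N to (b q)^N. *)
Lemma prefactor_a :
    poch (q ^+ 2) (q ^+ 2 / q ^+ n) N != 0 ->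
    poch (q ^+ 2) (q ^+ n * q ^+ 2) N != 0 ->
  (1 - q ^+ n * q ^+ n.+1) * poch (q ^+ 2) q^-1 N * poch (q ^+ 2) (q ^+ n) N
    * poch (q ^+ 2) (q ^+ n.+1)^-1 N * poch (q ^+ 2) (q^-2 / b) N * (b * q ^+ 4) ^+ N
    / (poch (q ^+ 2) (q ^+ 2) N * poch (q ^+ 2) (q ^+ 2 / q ^+ n) N
       * poch (q ^+ 2) (q ^+ n * q ^+ 2) N * poch (q ^+ 2) (b * q ^+ 2) N)
  = (1 - q ^+ n)
    * ((b * q) ^+ N * poch (q ^+ 2) (q^-2 / b) N / poch (q ^+ 2) (b * q ^+ 2) N).
Proof.
have nmb := le_nz (nd_mb nd); have nqq := le_nz (nd_qq nd).
have -> : poch (q ^+ 2) (q ^+ 2 / q ^+ n) N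
    = \prod_(i < N) - (q^-1 * (q ^+ 2) ^+ i)^-1 * poch (q ^+ 2) q^-1 N.
  apply: poch_revr => //; rewrite -exprM -nE (exprS q n); field.
  by rewrite q0 expf_neq0.
rewrite mulf_eq0 negb_or => /andP[h1 h2] h3.
rewrite rev_top (_ : \prod_(i < N) - (q ^+ 2 * (q ^+ 2) ^+ i)^-1 =
  (q ^- 3) ^+ N * \prod_(i < N) - (q^-1 * (q ^+ 2) ^+ i)^-1); last first.
  rewrite (exprN_prod (q ^- 3)) -big_split; apply: eq_bigr => i _ /=.
  by field; rewrite q0 expf_neq0.
have -> : (b * q ^+ 4) ^+ N = (q ^+ 3) ^+ N * (b * q) ^+ N.
  by rewrite -exprMn; congr (_ ^+ _); ring.
rewrite exprVn.
have q3 : (q ^+ 3) ^+ N != 0 by rewrite !expf_neq0.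
have e := shift_qn.
set z := (1 - q ^+ n * q ^+ n.+1) in e *.
rewrite [z * _ * _]mulrAC {}e.
move: (\prod_(i < N) _) h1 (poch _ q^-1 N) h2 (poch _ (q ^+ n * _) N) h3 => u hu v hv w hw.
move: (poch _ (b * _) _) nmb (poch _ (q ^+ 2) N) nqq ((q ^+ 3) ^+ N) q3 => x hx y hy t ht.
by field; rewrite hu hv hw hx hy ht.
Qed.

(** Here (q^-2/b)_N reverses to (q^3)_N, and by [e1] the monomials of both reversals cancel against
    (b q^4)^N. *)
Lemma prefactor_b : b = q ^+ n ->
  (1 - q ^+ n * q ^+ n.+1) * poch (q ^+ 2) q^-1 N * poch (q ^+ 2) (q ^+ n) N
    * poch (q ^+ 2) (q ^+ n.+1)^-1 N * poch (q ^+ 2) (q^-2 / b) N * (b * q ^+ 4) ^+ N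
    / (poch (q ^+ 2) (q ^+ 2) N * poch (q ^+ 2) (q ^+ 2 / a) N
       * poch (q ^+ 2) (a * q ^+ 2) N * poch (q ^+ 2) (b * q ^+ 2) N)
  = (1 - q ^+ n) * (poch (q ^+ 2) b 2 * (poch (q ^+ 2) q^-1 N) ^+ 2
       / (poch (q ^+ 2) q^-1 2 * poch (q ^+ 2) (q ^+ 2 / a) N
          * poch (q ^+ 2) (a * q ^+ 2) N)).
Proof.
move=> eb.
have nVa := le_nz (nd_Va nd); have nma := le_nz (nd_ma nd).
have nmb := le_nz (nd_mb nd); have nqq := le_nz (nd_qq nd).
have q1 := nd_q1 nd.
have -> : poch (q ^+ 2) (q^-2 / b) N
    = \prod_(i < N) - (q^-2 / b * (q ^+ 2) ^+ i) * poch (q ^+ 2) (q ^+ 3) N.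
  apply: poch_rev => //; rewrite -exprM -nE (exprS q n) eb; field.
  by rewrite q0 expf_neq0.
have e1 : \prod_(i < N) - (q ^+ 2 * (q ^+ 2) ^+ i)^-1
   * \prod_(i < N) - (q^-2 / b * (q ^+ 2) ^+ i) * (b * q ^+ 4) ^+ N = 1.
  rewrite (exprN_prod (b * q ^+ 4)) -!big_split big1 // => i _ /=.
  by field; rewrite q0 expf_neq0 ?b0.
(* Both sides are (q^-1;q^2)_{N+2}, split after 2 and after [N] factors; this produces the symbols
   of length 2 in [theta]. *)
have e2 : poch (q ^+ 2) (q ^+ 3) N * poch (q ^+ 2) q^-1 2
    = poch (q ^+ 2) q^-1 N * poch (q ^+ 2) b 2.
  transitivity (poch (q ^+ 2) q^-1 N.+2).
    rewrite [poch _ _ N.+2]pochSl [poch _ _ N.+1]pochSl [poch _ _ 2]pochSl [poch _ _ 1]pochSl poch0.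
    have -> : q^-1 * q ^+ 2 * q ^+ 2 = q ^+ 3 by field.
    by ring.
  rewrite !pochS poch0 (exprS _ N) [q^-1 * (_ * _)]mulrCA alN eb; ring.
have hq2 : poch (q ^+ 2) q^-1 2 != 0.
  rewrite !pochS poch0 mul1r expr0 mulr1 expr1 mulf_neq0 //.
    have -> : 1 - q^-1 = - ((1 - q) / q) by field.
    by rewrite oppr_eq0 mulf_neq0 ?invr_neq0.
  by have -> : q^-1 * q ^+ 2 = q by field.
rewrite rev_top; have e := shift_qn; rewrite -eb in e *.
set z := (1 - b * q ^+ n.+1) in e *.
transitivity ((z * poch (q ^+ 2) b N) * poch (q ^+ 2) q^-1 N
  * (\prod_(i < N) - (q ^+ 2 * (q ^+ 2) ^+ i)^-1
     * \prod_(i < N) - (q^-2 / b * (q ^+ 2) ^+ i) * (b * q ^+ 4) ^+ N)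
  * (poch (q ^+ 2) (q ^+ 3) N * poch (q ^+ 2) q^-1 2)
  / (poch (q ^+ 2) (q ^+ 2 / a) N
       * poch (q ^+ 2) (a * q ^+ 2) N * poch (q ^+ 2) (b * q ^+ 2) N * poch (q ^+ 2) q^-1 2)).
  move: (\prod_(i < N) _) (\prod_(i < N) _) (_ ^+ N) => P1 P2 P3.
  move: (poch _ q^-1 N) (poch _ q^-1 2) hq2 (poch _ (b * _) N) nmb => v v2 hv w hw.
  move: (poch _ (a * _) _) nma (poch _ (_ / a) _) nVa (poch _ (q ^+ 2) N) nqq => x hx y hy t ht.
  by field; rewrite hv hw hx hy ht.
rewrite e e1 e2.
move: (poch _ q^-1 N) (poch _ q^-1 2) hq2 (poch _ (b * _) N) nmb => v v2 hv w hw.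
move: (poch _ (a * _) _) nma (poch _ (_ / a) _) nVa (poch _ (q ^+ 2) N) nqq => x hx y hy t ht.
by field; rewrite hv hw hx hy.
Qed.

Lemma sides_eq_a : a * q ^+ n = 1 \/ a = q ^+ n ->
  \sum_(0 <= k < M.+1) lhs_term k
  = (1 - q ^+ n) / (1 - q) * theta n * \sum_(0 <= k < N.+1) rhs_term k.
Proof.
move=> ha; have ab := nd_ab nd; have ab1 := nd_1ab nd.
(* At a = q^n and at a = q^-n the second summand of [theta] vanishes and the rational factor of the
   first equals 1. *)
have -> : theta n
    = (b * q) ^+ N * poch (q ^+ 2) (q^-2 / b) N / poch (q ^+ 2) (b * q ^+ 2) N.
  rewrite /theta -[RHS]mul1r -[RHS]addr0; congr (_ * _ + _).
    case: ha => [e|<-]; last by field; rewrite ab ab1.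
    have -> : q ^+ n = a^-1 by apply: (mulfI a0); rewrite e mulfV.
    by field; rewrite ab ab1 a0.
  by case: ha => ->; rewrite subrr !(mulr0, mul0r).
rewrite lhs_sum //; last first.
  by case: ha => e; [apply: Or42|apply: Or43; rewrite -e mulfV].
congr (_ * _); rewrite [RHS]mulrAC mulrC; congr (_ / _).
have nVa := le_nz (nd_Va nd); have nma := le_nz (nd_ma nd).
case: ha => [e|e]; last by rewrite e in nVa nma *; apply: prefactor_a.
(* The prefactor is symmetric under a -> 1/a, which reduces a = q^-n to [prefactor_a]. *)
have e1 : q ^+ 2 / a = q ^+ n * q ^+ 2.
  by rewrite mulrC; congr (_ * _); apply: (mulfI a0); rewrite e mulfV.
have e2 : a * q ^+ 2 = q ^+ 2 / q ^+ n.
  rewrite mulrC; congr (_ * _); apply: (mulIf (expf_neq0 n q0)).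
  by rewrite e mulVf ?expf_neq0.
rewrite e1 e2 in nVa nma *; rewrite -prefactor_a //.
by congr (_ / _); rewrite -!mulrA; congr (_ * _); rewrite mulrCA.
Qed.

Lemma sides_eq_b : b = q ^+ n ->
  \sum_(0 <= k < M.+1) lhs_term k
  = (1 - q ^+ n) / (1 - q) * theta n * \sum_(0 <= k < N.+1) rhs_term k.
Proof.
move=> e; have ab := nd_ab nd; have ab1 := nd_1ab nd.
rewrite lhs_sum //; last by apply: Or44; rewrite -e mulfV.
congr (_ * _); rewrite [RHS]mulrAC mulrC; congr (_ / _).
rewrite prefactor_b //; congr (_ * _).
(* At b = q^n the first summand of [theta] vanishes and the rational factor of the second equals
   1. *)
rewrite /theta -e subrr !mul0r add0r -[LHS]mul1r; congr (_ * _).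
by field; rewrite ab ab1.
Qed.

End Sides.

(** * Specialization of rational functions *)

HB.instance Definition _ := GRing.RMorphism.copy toRF (@FracField.tofrac MPol).

Lemma toRF_eq0 p : (toRF p == 0) = (p == 0).
Proof. exact: tofrac_eq0. Qed.

Lemma toRF_inj : injective toRF.
Proof. by move=> p r /eqP; rewrite tofrac_eq => /eqP. Qed.

Section Specialization.

Variables (K : fieldType) (phi : {rmorphism MPol -> K}).

(* [x] lies in the localization of the polynomial ring at the kernel of [phi],
   and [y] is its image under the extension of [phi]. *)
Definition spec (x : RF) (y : K) : Prop :=
  exists N D, [/\ phi D != 0, x = toRF N / toRF D & y = phi N / phi D].

Let toRF_neq0 D : phi D != 0 -> toRF D != 0.
Proof. by rewrite toRF_eq0; apply: contra => /eqP->; rewrite rmorph0. Qed.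

Lemma spec_toRF p : spec (toRF p) (phi p).
Proof. by exists p, 1; rewrite !rmorph1 oner_neq0 !divr1. Qed.

Lemma spec1 : spec 1 1.
Proof. by have := spec_toRF 1; rewrite !rmorph1. Qed.

Lemma specD x y x' y' : spec x y -> spec x' y' -> spec (x + x') (y + y').
Proof.
case=> N [D [D0 -> ->]] [N' [D' [D'0 -> ->]]].
exists (N * D' + N' * D), (D * D'); rewrite !(rmorphD, rmorphM) /=.
by rewrite mulf_neq0 // !addf_div ?toRF_neq0.
Qed.

Lemma specN x y : spec x y -> spec (- x) (- y).
Proof.
by case=> N [D [D0 -> ->]]; exists (- N), D; rewrite !rmorphN !mulNr.
Qed.

Lemma specM x y x' y' : spec x y -> spec x' y' -> spec (x * x') (y * y').
Proof.
case=> N [D [D0 -> ->]] [N' [D' [D'0 -> ->]]].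
by exists (N * N'), (D * D'); rewrite !rmorphM mulf_neq0 // !mulf_div.
Qed.

Lemma specV x y : y != 0 -> spec x y -> spec x^-1 y^-1.
Proof.
move=> y0 [N [D [D0 ex ey]]]; exists D, N; rewrite ex ey !invf_div; split=> //.
by move: y0; rewrite ey mulf_eq0 negb_or => /andP[].
Qed.

Lemma spec_div x y x' y' : y' != 0 -> spec x y -> spec x' y' -> spec (x / x') (y / y').
Proof. by move=> y0 sx sx'; apply: specM sx (specV y0 sx'). Qed.

Lemma specX x y k : spec x y -> spec (x ^+ k) (y ^+ k).
Proof.
by move=> s; elim: k => [|k IH]; [apply: spec1 | rewrite !exprS; apply: specM].
Qed.

Lemma spec_sum m k (F : nat -> RF) (G : nat -> K) :
    (forall i, (m <= i < k)%N -> spec (F i) (G i)) ->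
  spec (\sum_(m <= i < k) F i) (\sum_(m <= i < k) G i).
Proof.
move=> h; rewrite !big_nat; elim/big_ind2: _ => //; last by move=> *; apply: specD.
by have := spec_toRF 0; rewrite !rmorph0.
Qed.

Lemma spec_poch p r x y k : spec p r -> spec x y -> spec (poch p x k) (poch r y k).
Proof.
move=> sp sx; rewrite /poch; elim/big_ind2: _ => [|? ? ? ? s1 s2|i _].
- exact: spec1.
- exact: specM.
- by apply: specD spec1 (specN _); apply: specM sx (specX _ sp).
Qed.

Variables (n M : nat).
Local Notation N := (n.+1)./2.
Local Notation q := (phi mq).
Local Notation a := (phi ma).
Local Notation b := (phi mb).
Local Notation c := (phi mc).
Local Notation d := (phi md).
Hypothesis nd : nondegenerate q a b c d n M.
Hypothesis NM : (N <= M)%N.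

Let sq : spec q_ q. Proof. exact: spec_toRF. Qed.
Let sa : spec a_ a. Proof. exact: spec_toRF. Qed.
Let sb : spec b_ b. Proof. exact: spec_toRF. Qed.
Let sc : spec c_ c. Proof. exact: spec_toRF. Qed.
Let sd : spec d_ d. Proof. exact: spec_toRF. Qed.
Let nz_le x k : (k <= M)%N -> poch (q ^+ 2) x M != 0 -> poch (q ^+ 2) x k != 0.
Proof. exact: poch_neq0_le. Qed.

Ltac spec_tac := repeat first
  [ exact sq | exact sa | exact sb | exact sc | exact sd | exact spec1
  | apply: spec_div | apply: specD | apply: specN | apply: specM | apply: specX
  | apply: specV | apply: spec_poch ].

Let nzs := (mulf_neq0, expf_neq0, nd_q nd, nd_a nd, nd_b nd, nd_c nd, nd_d nd,
  nd_q1 nd, nd_ab nd, nd_1ab nd).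

Lemma spec_qint z : spec (qint q_ z) ((1 - q ^ z) / (1 - q)).
Proof.
apply: spec_div; first exact: nd_q1 nd; spec_tac.
(* Negative exponents do occur: 4k - 1 at k = 0. *)
case: z => z; rewrite -?exprnP -?NegzE /exprz; spec_tac.
by rewrite !nzs.
Qed.

Lemma spec_lhs_term k : (k <= M)%N ->
  spec (lhs_term q_ a_ b_ c_ d_ k) (lhs_term q a b c d k).
Proof.
move=> kM; have sz := spec_qint ((4 * k)%:Z - 1).
rewrite /lhs_term; apply: specM; last first.
  by spec_tac; rewrite !nzs.
apply: spec_div; first by rewrite !mulf_neq0 // nz_le //; case: nd.
  by apply: specM; [exact: sz | spec_tac; rewrite ?nzs].
by spec_tac; rewrite ?nzs.
Qed.

Lemma spec_rhs_term k : (k <= N)%N ->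
  spec (rhs_term q_ a_ b_ c_ d_ k) (rhs_term q a b c d k).
Proof.
move=> kN; rewrite /rhs_term; apply: specM; last by spec_tac.
have kM := leq_trans kN NM.
apply: spec_div; try by spec_tac; rewrite ?nzs.
rewrite !mulf_neq0 //; try by apply: nz_le => //; case: nd.
by apply: poch_neq0_le kN _; case: nd.
Qed.

Lemma spec_theta : spec (Theta n) (theta q a b n).
Proof.
have hq2 : poch (q ^+ 2) q^-1 2 != 0.
  rewrite !pochS poch0 mul1r expr0 mulr1 expr1 mulf_neq0 //.
    have -> : 1 - q^-1 = - ((1 - q) / q) by field; rewrite (nd_q nd).
    by rewrite oppr_eq0 mulf_neq0 ?invr_neq0 ?nzs.
  have -> : q^-1 * q ^+ 2 = q by field; rewrite (nd_q nd).
  by rewrite nzs.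
change (spec (theta q_ a_ b_ n) (theta q a b n)).
by rewrite /theta; spec_tac; rewrite ?nzs //; apply: nz_le => //; case: nd.
Qed.

End Specialization.

(** * Congruences modulo a product of primes *)

Lemma frac_cross (K : fieldType) (x n d n' d' : K) :
  d != 0 -> d' != 0 -> x = n / d -> x = n' / d' -> n * d' = n' * d.
Proof.
move=> d0 d'0 e e'; have -> : n = x * d by rewrite e divfK.
have -> : n' = x * d' by rewrite e' divfK.
exact: mulrAC.
Qed.

Lemma frac_combine (K : fieldType) (x n d n' d' e : K) :
    d != 0 -> d' != 0 -> d + e * d' != 0 -> x = n / d -> x = n' / d' ->
  x = (n + e * n') / (d + e * d').
Proof.
move=> d0 d'0 d20 ex ex'; have -> : n = x * d by rewrite ex divfK.
have -> : n' = x * d' by rewrite ex' divfK.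
by rewrite mulrCA -mulrDr mulfK.
Qed.

Lemma mdvd0 p : mdvd p 0.
Proof. by exists 0; rewrite mul0r. Qed.

Lemma mdvdD p f g : mdvd p f -> mdvd p g -> mdvd p (f + g).
Proof. by case=> s -> [t ->]; exists (s + t); rewrite mulrDl. Qed.

Lemma mdvdN p f : mdvd p f -> mdvd p (- f).
Proof. by case=> s ->; exists (- s); rewrite mulNr. Qed.

Lemma mdvd_mull p f g : mdvd p g -> mdvd p (f * g).
Proof. by case=> s ->; exists (f * s); rewrite mulrA. Qed.

Lemma mdvd_mulr p f g : mdvd p f -> mdvd p (f * g).
Proof. by rewrite mulrC; apply: mdvd_mull. Qed.

Lemma mdvd_refl p : mdvd p p.
Proof. by exists 1; rewrite mul1r. Qed.

Lemma mdvd_addl p f g : mdvd p g -> mdvd p (f + g) -> mdvd p f.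
Proof. by move=> hg h; rewrite -(addrK g f); apply: mdvdD h (mdvdN hg). Qed.

(** The third clause, decidable divisibility, supports the case split on denominators in
    [local_zero_prod]. *)
Definition mprime (p : MPol) : Prop :=
  [/\ p != 0, ~ mdvd p 1, forall f, mdvd p f \/ ~ mdvd p f
    & forall f g, mdvd p (f * g) -> mdvd p f \/ mdvd p g].

Definition has_kernel (K : fieldType) (phi : {rmorphism MPol -> K}) (p : MPol) : Prop :=
  forall f, phi f = 0 <-> mdvd p f.

(** The quotient by [p] embeds in a field, whose decidable equality decides divisibility by [p]. *)
Lemma has_kernel_prime (K : fieldType) (phi : {rmorphism MPol -> K}) p :
  p != 0 -> has_kernel phi p -> mprime p.
Proof.
move=> p0 kp; split=> // [/kp/eqP|f|f g /kp/eqP]; first by rewrite rmorph1 oner_eq0.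
  by have [/eqP/kp|f0] := boolP (phi f == 0); [left|right=> /kp/eqP; apply/negP].
by rewrite rmorphM mulf_eq0 => /orP[]/eqP/kp; [left|right].
Qed.

(** For prime [p], membership in the maximal ideal of the localization at [p]. *)
Definition local_zero (x : RF) (p : MPol) : Prop :=
  exists N D, [/\ ~ mdvd p D, mdvd p N & x = toRF N / toRF D].

Lemma spec_local_zero (K : fieldType) (phi : {rmorphism MPol -> K}) p x :
  has_kernel phi p -> spec phi x 0 -> local_zero x p.
Proof.
move=> kp [N [D [D0 -> /esym/eqP]]]; rewrite mulf_eq0 invr_eq0 (negPf D0) orbF.
by move=> /eqP/kp pN; exists N, D; split=> // /kp/eqP; apply/negP.
Qed.

Fixpoint independent (ps : seq MPol) : Prop :=
  if ps is p :: s then ~ mdvd p (\prod_(r <- s) r) /\ independent s else True.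

Lemma mdvd_prod (s : seq MPol) r : r \in s -> mdvd r (\prod_(t <- s) t).
Proof.
elim: s => // t s IH; rewrite inE big_cons => /orP[/eqP->|/IH].
  exact/mdvd_mulr/mdvd_refl.
exact: mdvd_mull.
Qed.

Lemma ndvd_toRF p D : ~ mdvd p D -> toRF D != 0.
Proof. by move=> h; rewrite toRF_eq0; apply/eqP => D0; apply: h; rewrite D0; apply: mdvd0. Qed.

(* If [D] is a denominator prime to every element of [s] but not to [p], and
   [D'] one prime to [p], then [D + e * D'], with [e] the product of [s], is
   prime to all of [p :: s]. *)
Lemma local_zero_prod u v (ps : seq MPol) : v != 0 ->
    (forall p, p \in ps -> mprime p /\ local_zero (toRF u / toRF v) p) ->
    independent ps ->
  exists N D, [/\ D != 0, forall p, p \in ps -> ~ mdvd p D,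
    mdvd (\prod_(p <- ps) p) N & toRF u / toRF v = toRF N / toRF D].
Proof.
move=> v0; elim: ps => [_ _|p s IH hp [pe /IH{}IH]].
  by exists u, v; split=> //; rewrite big_nil; exists u; rewrite mulr1.
case: IH => [r rs|N [D [D0 hD eN xE]]]; first by apply: hp; rewrite inE rs orbT.
have [[p0 _ pdec pP] [N' [D' [pD' pN' xE']]]] := hp p (mem_head p s).
set e := \prod_(r <- s) r in pe eN.
suff [N2 [D2 [hD2 eN2 xE2]]] : exists N2 D2, [/\ forall r, r \in p :: s -> ~ mdvd r D2,
    mdvd e N2 & toRF u / toRF v = toRF N2 / toRF D2].
  have pD2 := hD2 p (mem_head p s).
  exists N2, D2; split=> //; first by rewrite -toRF_eq0; apply: ndvd_toRF pD2.
  rewrite big_cons -/e.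
  (* [p] divides [N' * D2 = N2 * D'] but not [D'], hence divides [N2 = t * e]; as it does not divide
     [e], it divides [t]. *)
  have : mdvd p (N2 * D').
    suff -> : N2 * D' = N' * D2 by apply: mdvd_mulr.
    apply: toRF_inj; rewrite !rmorphM.
    exact: (frac_cross (ndvd_toRF pD2) (ndvd_toRF pD') xE2 xE').
  case/pP => // pN2; case: eN2 => t et; move: pN2; rewrite et => /pP[[s' ->]|//].
  by exists s'; rewrite mulrA.
have [pD|pD] := pdec D.
  exists (N + e * N'), (D + e * D'); split.
  - move=> r; rewrite inE => /orP[/eqP->|rs].
      by rewrite addrC => /(mdvd_addl pD)/pP[].
    by move=> h; apply: (hD r rs); apply: mdvd_addl h; apply/mdvd_mulr/mdvd_prod.
  - by apply: mdvdD eN _; apply/mdvd_mulr/mdvd_refl.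
  - have D20 : toRF (D + e * D') != 0.
      by apply: (@ndvd_toRF p); rewrite addrC => /(mdvd_addl pD)/pP[].
    have D1 : toRF D != 0 by rewrite toRF_eq0.
    move: D20; rewrite !rmorphD !rmorphM => D20.
    exact: (frac_combine D1 (ndvd_toRF pD') D20 xE xE').
by exists N, D; split=> // r; rewrite inE => /orP[/eqP->//|]; apply: hD.
Qed.

(** Write the product as [t * g]. Each prime divides [t], and is cancelled, or divides [g] and hence
    [D], which is excluded. In the end [g] divides 1 and is a constant. *)
Lemma mcoprime_prod (D : MPol) (ps : seq MPol) :
    (forall p, p \in ps -> mprime p /\ ~ mdvd p D) ->
  mcoprime D (\prod_(p <- ps) p).
Proof.
move=> hp g gD; elim: ps hp => [_|p s IH hp].
  rewrite big_nil => -[t /esym/mpoly_intro_unit]; rewrite unfold_in => /andP[/eqP e].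
  by rewrite unitfE; exists g@_0.
have [[p0 _ _ pP] pD] := hp p (mem_head p s).
rewrite big_cons => -[t et].
have : mdvd p (t * g) by rewrite -et; apply/mdvd_mulr/mdvd_refl.
case/pP => [[t' et']|[g' eg]].
  apply: IH => [r rs|]; first by apply: hp; rewrite inE rs orbT.
  by exists t'; apply: (mulfI p0); rewrite et et' mulrCA mulrA.
case: pD; case: gD => w ->; rewrite eg mulrA.
by apply/mdvd_mull/mdvd_refl.
Qed.

Lemma cong_mod_prod (A B : RF) (ps : seq MPol) :
    (exists u v, v != 0 /\ A - B = toRF u / toRF v) ->
    (forall p, p \in ps -> mprime p /\ local_zero (A - B) p) ->
    independent ps ->
  cong_mod A B (\prod_(p <- ps) p).
Proof.
case=> u [v [v0 e]]; rewrite /cong_mod e => hp ind.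
have [N [D [D0 hD PN eN]]] := local_zero_prod v0 hp ind.
exists N, D; split=> //; split; last by [].
by apply: mcoprime_prod => p ps_p; split; [case: (hp p ps_p)|apply: hD].
Qed.

(** * Homomorphisms with kernel a factor of the modulus *)

Lemma mpoly_ring_ind (P : MPol -> Prop) :
    (forall c, P c%:MP) -> (forall i, P 'X_i) ->
    (forall f g, P f -> P g -> P (f + g)) -> (forall f g, P f -> P g -> P (f * g)) ->
  forall f, P f.
Proof.
move=> PC PX PD PM f; rewrite (mpolyE f).
apply: (big_ind P) => [|//|m _]; first by rewrite -mpolyC0.
rewrite -mul_mpolyC; apply: (PM) => //; rewrite mpolyXE_id.
apply: (big_ind P) => [|//|i _]; first by rewrite -mpolyC1.
by elim: (m i) => [|k IH]; [rewrite expr0 -mpolyC1|rewrite exprS; apply: PM].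
Qed.

(** With [red_mul], shows that the errors of two reductions combine linearly under sums and
    products. *)
Lemma red_add (R : comRingType) (f f' x y g g' : R) :
  (f + f') * (x * y) - (g * y + g' * x) = y * (f * x - g) + x * (f' * y - g').
Proof. by ring. Qed.

Lemma red_mul (R : comRingType) (f f' x y g g' : R) :
  f * f' * (x * y) - g * g' = f' * y * (f * x - g) + g * (f' * y - g').
Proof. by ring. Qed.

(** * Substituting for one variable: the three linear factors *)

Section Substitution.

Variables (j : 'I_5) (v : RF).

Definition subst_fun (i : 'I_5) : RF := if i == j then v else toRF 'X_i.

Definition subst : MPol -> RF := mmap (toRF \o @mpolyC 5 rat) subst_fun.

HB.instance Definition _ := GRing.RMorphism.on subst.

Lemma substX i : subst 'X_i = if i == j then v else toRF 'X_i.
Proof. by rewrite /subst mmapX mmap1U. Qed.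

Lemma substC c : subst c%:MP = toRF c%:MP.
Proof. by rewrite /subst mmapC. Qed.

Variables (p w s t : MPol).
Hypotheses (vE : v * toRF s = toRF w) (pX : mdvd p ('X_j * s - w))
  (pst : mdvd p (s * t - 1)) (p_ker : subst p = 0).

(* [s * 'X_j = w] modulo [p], so every [f] is congruent to a polynomial
   fixed by [subst], up to a power of [s], which is a unit modulo [p]. *)
Let reduce f : exists m g, subst f * toRF s ^+ m = toRF g /\ mdvd p (f * s ^+ m - g).
Proof.
elim/mpoly_ring_ind: f => [c|i|f f' [m [g [e h]]] [m' [g' [e' h']]]|
  f f' [m [g [e h]]] [m' [g' [e' h']]]].
- by exists 0, c%:MP; rewrite !expr0 !mulr1 substC subrr; split=> //; apply: mdvd0.
- have [->|ij] := eqVneq i j.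
    by exists 1, w; rewrite !expr1 substX eqxx.
  by exists 0, 'X_i; rewrite !expr0 !mulr1 substX (negPf ij) subrr; split=> //; apply: mdvd0.
- exists (m + m')%N, (g * s ^+ m' + g' * s ^+ m); split.
    rewrite !rmorphD !rmorphM /= -e -e' !rmorphXn /= mulrDl !exprD !mulrA.
    by congr (_ + _); rewrite mulrAC.
  rewrite exprD red_add.
  by apply: mdvdD; apply: mdvd_mull.
- exists (m + m')%N, (g * g'); split.
    by rewrite !rmorphM /= -e -e' exprD mulrACA.
  rewrite exprD red_mul.
  by apply: mdvdD; apply: mdvd_mull.
Qed.

(** If [subst f = 0], the reduced form of [f] is 0, so [p] divides [f * s ^+ m]; multiplying by
    [t ^+ m] removes the power of [s] modulo [p]. *)
Lemma subst_kernel : has_kernel subst p.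
Proof.
move=> f; split=> [f0|[g ->]]; last by rewrite rmorphM /= p_ker mulr0.
have [m [g [/esym/eqP]]] := reduce f.
rewrite f0 mul0r toRF_eq0 => /eqP->; rewrite subr0 => h.
have h1 : mdvd p ((s * t) ^+ m - 1).
  by rewrite subrX1; apply: mdvd_mulr.
have -> : f = f * s ^+ m * t ^+ m - f * ((s * t) ^+ m - 1).
  by rewrite mulrBr mulr1 exprMn mulrA opprB addrC subrK.
by apply: mdvdD; [apply: mdvd_mulr|apply/mdvdN/mdvd_mull].
Qed.

End Substitution.

(** * Sending q to a root of unity: the cyclotomic factor *)

Section CyclotomicSpecialization.

Variables (n : nat) (z : algC).
Hypothesis prim_z : n.-primitive_root z.

(* [split_q] regards a polynomial as one in [a, b, c, d] with coefficients in
   [rat[q]]; the variable of index 0 is kept but never occurs in its values. *)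
Let PQ := {poly rat}.

Definition split_q : MPol -> {mpoly PQ[5]} :=
  mmap (@mpolyC 5 PQ \o @polyC rat)
    (fun i => if i == inord 0 then ('X : PQ)%:MP else 'X_i).

HB.instance Definition _ := GRing.RMorphism.on split_q.

Definition at_q : PQ -> MPol := horner_eval mq \o map_poly (@mpolyC 5 rat).

HB.instance Definition _ := GRing.RMorphism.on at_q.

Definition merge_q : {mpoly PQ[5]} -> MPol := mmap at_q (fun i => 'X_i).

HB.instance Definition _ := GRing.RMorphism.on merge_q.

Definition at_z : PQ -> algC := horner_eval z \o map_poly (ratr : rat -> algC).

HB.instance Definition _ := GRing.RMorphism.on at_z.

Definition cyc_map : MPol -> {mpoly algC[5]} := map_mpoly at_z \o split_q.

HB.instance Definition _ := GRing.RMorphism.on cyc_map.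

Definition cyc : MPol -> {fraction {mpoly algC[5]}} :=
  @FracField.tofrac {mpoly algC[5]} \o cyc_map.

HB.instance Definition _ := GRing.RMorphism.on cyc.

Lemma at_qC c : at_q c%:P = c%:MP.
Proof. by rewrite /at_q /= map_polyC /horner_eval hornerC. Qed.

Lemma at_qX : at_q 'X = mq.
Proof. by rewrite /at_q /= map_polyX /horner_eval hornerX. Qed.

Lemma at_zX : at_z 'X = z.
Proof. by rewrite /at_z /= map_polyX /horner_eval hornerX. Qed.

Lemma split_qX i : split_q 'X_i = if i == inord 0 then ('X : PQ)%:MP else 'X_i.
Proof. by rewrite /split_q mmapX mmap1U. Qed.

Lemma split_qK f : merge_q (split_q f) = f.
Proof.
elim/mpoly_ring_ind: f => [c|i|f g ef eg|f g ef eg].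
- by rewrite /split_q mmapC /merge_q mmapC /= at_qC.
- rewrite split_qX; case: eqP => [->|_]; last by rewrite /merge_q mmapX mmap1U.
  by rewrite /merge_q mmapC /= at_qX.
- by rewrite !rmorphD /= ef eg.
- by rewrite !rmorphM /= ef eg.
Qed.

Lemma at_qK F : split_q (at_q F) = F%:MP.
Proof.
elim/poly_ind: F => [|F c IH]; first by rewrite !rmorph0.
rewrite !(rmorphD, rmorphM) /= IH; congr (_ * _ + _).
  by rewrite at_qX split_qX eqxx.
by rewrite at_qC /split_q mmapC.
Qed.

(** The cyclotomic polynomial is the minimal polynomial over the rationals of a primitive n-th root
    of unity. *)
Lemma at_z_eq0 (F : PQ) : at_z F = 0 <-> map_poly intr 'Phi_n %| F.
Proof.
have [P [eP monP] dvP] := minCpolyP z.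
have -> : map_poly intr 'Phi_n = P.
  apply: (map_poly_inj (ratr : rat -> algC)); rewrite -eP (minCpoly_cyclotomic prim_z).
  rewrite -(Cintr_Cyclotomic prim_z) -map_poly_comp; apply: eq_map_poly => b.
  by rewrite /= rmorph_int.
rewrite -dvP /root /at_z /= /horner_eval; by split=> /eqP.
Qed.

Lemma at_q_Phi : at_q (map_poly intr 'Phi_n) = PhiQ n.
Proof.
rewrite /at_q /= /horner_eval /PhiQ -map_poly_comp; congr (_.[_]).
by apply: eq_map_poly => b; rewrite /= rmorph_int.
Qed.

Lemma PhiQ_neq0 : PhiQ n != 0.
Proof.
apply/eqP => /(congr1 split_q)/eqP; rewrite -at_q_Phi at_qK rmorph0 mpolyC_eq0.
apply/negP/monic_neq0/(monic_map (intr : {rmorphism int -> rat})).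
exact: Cyclotomic_monic.
Qed.

Lemma cyc_mapX i :
  cyc_map 'X_i = if i == inord 0 then z%:MP else 'X_i.
Proof.
rewrite /cyc_map /= split_qX; case: eqP => _.
  by rewrite map_mpolyC /= at_zX.
by rewrite /map_mpoly mmapX mmap1U.
Qed.

(** The image of [f] vanishes only if each coefficient of [split_q f] vanishes at [z], that is, is a
    multiple of the cyclotomic polynomial; [merge_q] reassembles [f] from these multiples. *)
Lemma cyc_kernel : has_kernel cyc (PhiQ n).
Proof.
move=> f; split.
  rewrite /cyc /= => /eqP; rewrite tofrac_eq0 => /eqP f0.
  rewrite -(split_qK f) /merge_q /mmap.
  apply: (big_ind (mdvd (PhiQ n))) => [|? ? ? ?|m _]; first exact: mdvd0.
    exact: mdvdD.
  apply: mdvd_mulr.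
  have /at_z_eq0/dvdpP[G ->] : at_z (split_q f)@_m = 0.
    by rewrite -mcoeff_map_mpoly [map_mpoly _ _]f0 mcoeff0.
  by exists (at_q G); rewrite rmorphM /= at_q_Phi.
case=> g ->; rewrite rmorphM /=.
suff -> : cyc (PhiQ n) = 0 by rewrite mulr0.
rewrite /cyc /=; apply/eqP; rewrite tofrac_eq0 /cyc_map /= -at_q_Phi.
rewrite at_qK map_mpolyC /= (_ : at_z _ = 0) ?mpolyC0 //; exact/at_z_eq0.
Qed.

End CyclotomicSpecialization.

(** * Nondegeneracy and conclusion *)

Section Nondegeneracy.

Variables (K : fieldType) (q : K).
Hypothesis q0 : q != 0.

Let qE i : (q ^+ 2) ^+ i = q ^+ (2 * i). Proof. by rewrite exprM. Qed.

Lemma poch_mul_neq0 x y k : y != 0 -> (forall i, (i < k)%N -> x * q ^+ (2 * i) != y) ->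
  poch (q ^+ 2) (x / y) k != 0.
Proof.
move=> y0 h; apply/poch_neq0 => i /h; rewrite qE; apply: contra.
by rewrite subr_eq0 mulrAC => /eqP e; rewrite -[x * _](divfK y0) -e mul1r.
Qed.

(** For nonzero q: [x] is no integer power of q, negative exponents being cleared. *)
Definition q_generic (x : K) : Prop := forall k l, x * q ^+ k != q ^+ l.

Variables (a b c d : K) (n M : nat).
Local Notation N := (n.+1)./2.
Hypotheses (n1 : (1 < n)%N) (oddn : odd n) (NM : (N <= M)%N).
Hypotheses (c0 : c != 0) (d0 : d != 0) (gc : q_generic c) (gd : q_generic d).

(** Adds the three numerator symbols that [wp_moment0] divides out. *)
Definition nondegenerate_top : Prop :=
  [/\ nondegenerate q a b c d n M, poch (q ^+ 2) (a / q) N != 0,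
      poch (q ^+ 2) (q^-1 / a) N != 0 & poch (q ^+ 2) (q^-1 / b) N != 0].

Lemma nondegenerate_topI :
    a != 0 -> b != 0 ->
    (forall i, (i < M)%N -> q ^+ (2 * i + 2) != 1) ->
    (forall i, a != q ^+ (2 * i + 2)) -> (forall i, a * q ^+ (2 * i + 2) != 1) ->
    (forall i, b * q ^+ (2 * i + 2) != 1) -> (forall i, b * q ^+ 2 != q ^+ (2 * i)) ->
    a != b -> a * b != 1 ->
    (forall i, (i < N)%N -> a * q ^+ (2 * i) != q) ->
    (forall i, (i < N)%N -> q ^+ (2 * i) != q * a) ->
    (forall i, (i < N)%N -> q ^+ (2 * i) != q * b) ->
  nondegenerate_top.
Proof.
move=> a0 b0 hq ha ha' hb hb' ab ab1 hD hE hF.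
have M0 : (0 < M)%N by apply: leq_trans NM; rewrite half_gt0; apply: ltnW.
have qS i : q ^+ 2 * q ^+ (2 * i) = q ^+ (2 * i + 2) by rewrite -exprD addnC.
split; first split => //.
- by apply: contra (hq 0%N M0); rewrite subr_eq0 muln0 => /eqP<-; rewrite expr1n.
- by rewrite subr_eq0.
- by rewrite subr_eq0 eq_sym.
- by apply: poch_mul_neq0 => // i _; rewrite qS eq_sym.
- rewrite -[a * _]divr1; apply: poch_mul_neq0 => [|i _]; first exact: oner_neq0.
  by rewrite -mulrA qS.
- rewrite -[b * _]divr1; apply: poch_mul_neq0 => [|i _]; first exact: oner_neq0.
  by rewrite -mulrA qS.
- by apply: poch_mul_neq0 => // i _; rewrite qS eq_sym -[c]mulr1 (gc 0).
- by apply: poch_mul_neq0 => // i _; rewrite qS eq_sym -[d]mulr1 (gd 0).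
- rewrite -[X in poch _ X]divr1; apply: poch_mul_neq0 => [|i iM]; first exact: oner_neq0.
  by rewrite qS hq.
- rewrite -invfM -[X in poch _ X]mul1r; apply: poch_mul_neq0 => [|i _].
    by rewrite mulf_neq0 ?expf_neq0.
  by rewrite mul1r eq_sym mulrC.
- exact: poch_mul_neq0.
- rewrite -invfM -[X in poch _ X]mul1r; apply: poch_mul_neq0 => [|i iN].
    by rewrite mulf_neq0.
  by rewrite mul1r hE.
- rewrite -invfM -[X in poch _ X]mul1r; apply: poch_mul_neq0 => [|i iN].
    by rewrite mulf_neq0.
  by rewrite mul1r hF.
Qed.

Let nE : n.+1 = (2 * N)%N.
Proof. by rewrite mul2n -[LHS]odd_double_half /= oddn. Qed.

(** Coincidences between a and powers of q become equations between exponents, excluded by the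
    parity of n or by [i < N]; those with b are excluded by genericity. *)
Lemma nondegenerate_top_a : b != 0 -> q_generic b ->
    (forall k l, q ^+ k = q ^+ l -> k = l) -> a * q ^+ n = 1 \/ a = q ^+ n ->
  nondegenerate_top.
Proof.
move=> b0 gb qI ha.
have qn0 : q ^+ n != 0 by rewrite expf_neq0.
have a0 : a != 0.
  by case: ha => [e|-> //]; apply/eqP => e'; move/eqP: e; rewrite e' mul0r eq_sym oner_eq0.
have neq k l : k <> l -> q ^+ k != q ^+ l by move=> h; apply/eqP => /qI.
have h1 k l : (k + n <> l)%N -> (k <> l + n)%N -> a * q ^+ k != q ^+ l.
  move=> kl lk; case: ha => [e|->]; last by rewrite -exprD neq // addnC.
  by apply/eqP => e'; case: lk; apply: qI; rewrite exprD -e' mulrAC e mul1r.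
apply: nondegenerate_topI => //.
- by move=> i _; rewrite -(expr0 q); apply: neq; lia.
- by move=> i; rewrite -[a]mulr1 -(expr0 q); apply: h1; lia.
- by move=> i; rewrite -(expr0 q); apply: h1; lia.
- by move=> i; rewrite -(expr0 q); apply: gb.
- case: ha => [e|->]; last by rewrite eq_sym -[b]mulr1 -(expr0 q); apply: gb.
  by apply: contra (gb n 0) => /eqP<-; rewrite e.
- case: ha => [e|->]; last by rewrite mulrC -(expr0 q); apply: gb.
  apply: contra (gb 0 n) => /eqP e'.
  by rewrite expr0 mulr1 -[X in _ == X]mulr1 -e' mulrA [_ * a]mulrC e mul1r.
- by move=> i iN; rewrite -[X in _ != X]expr1; apply: h1; lia.
- by move=> i iN; rewrite eq_sym mulrC -[X in _ * X]expr1; apply: h1; lia.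
- by move=> i iN; rewrite eq_sym mulrC -[X in _ * X]expr1; apply: gb.
Qed.

Lemma nondegenerate_top_b : a != 0 -> q_generic a ->
    (forall k l, q ^+ k = q ^+ l -> k = l) -> b = q ^+ n ->
  nondegenerate_top.
Proof.
move=> a0 ga qI eb.
have neq k l : k <> l -> q ^+ k != q ^+ l by move=> h; apply/eqP => /qI.
apply: nondegenerate_topI; rewrite ?eb //.
- by rewrite expf_neq0.
- by move=> i _; rewrite -(expr0 q); apply: neq; lia.
- by move=> i; rewrite -[a]mulr1 -(expr0 q); apply: ga.
- by move=> i; rewrite -(expr0 q); apply: ga.
- by move=> i; rewrite -(expr0 q) -exprD; apply: neq; lia.
- by move=> i; rewrite -exprD; apply: neq; lia.
- by rewrite -[a]mulr1 -(expr0 q); apply: ga.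
- by rewrite -(expr0 q); apply: ga.
- by move=> i iN; rewrite -[X in _ != X]expr1; apply: ga.
- by move=> i iN; rewrite eq_sym mulrC -[X in _ * X]expr1; apply: ga.
- by move=> i iN; rewrite -exprS; apply: neq; lia.
Qed.

Lemma nondegenerate_top_root : a != 0 -> b != 0 -> q_generic a -> q_generic b ->
    a != b -> a * b != 1 -> (M < n)%N -> n.-primitive_root q ->
  nondegenerate_top.
Proof.
move=> a0 b0 ga gb ab ab1 Mn prim_q.
apply: nondegenerate_topI => //.
- move=> i iM; rewrite -(prim_order_dvd prim_q) (_ : 2 * i + 2 = 2 * i.+1)%N; last lia.
  (* As n is odd, it would have to divide [i.+1], but [i.+1 <= M < n]. *)
  rewrite Gauss_dvdr ?coprimen2 //; apply/negP => /dvdn_leq; lia.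
- by move=> i; rewrite -[a]mulr1 -(expr0 q); apply: ga.
- by move=> i; rewrite -(expr0 q); apply: ga.
- by move=> i; rewrite -(expr0 q); apply: gb.
- by move=> i iN; rewrite -[X in _ != X]expr1; apply: ga.
- by move=> i iN; rewrite eq_sym mulrC -[X in _ * X]expr1; apply: ga.
- by move=> i iN; rewrite eq_sym mulrC -[X in _ * X]expr1; apply: gb.
Qed.

End Nondegeneracy.

Section SpecializedSides.

Variables (K : fieldType) (phi : {rmorphism MPol -> K}) (n M : nat).
Local Notation N := (n.+1)./2.

Lemma spec_sides_sub :
    (N <= M)%N ->
    nondegenerate (phi mq) (phi ma) (phi mb) (phi mc) (phi md) n M ->
    \sum_(0 <= k < M.+1) lhs_term (phi mq) (phi ma) (phi mb) (phi mc) (phi md) k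
    = (1 - phi mq ^+ n) / (1 - phi mq) * theta (phi mq) (phi ma) (phi mb) n
      * \sum_(0 <= k < N.+1) rhs_term (phi mq) (phi ma) (phi mb) (phi mc) (phi md) k ->
  spec phi (\sum_(0 <= k < M.+1) lhs_term q_ a_ b_ c_ d_ k
    - qint q_ n%:Z * Theta n * \sum_(0 <= k < N.+1) rhs_term q_ a_ b_ c_ d_ k) 0.
Proof.
move=> NM nd e.
rewrite -[X in spec _ _ X](subrr (\sum_(0 <= k < M.+1)
  lhs_term (phi mq) (phi ma) (phi mb) (phi mc) (phi md) k)).
apply: specD.
  by apply: spec_sum => k /andP[_ kM]; apply: spec_lhs_term nd _ _.
apply: specN; rewrite {}e; apply: specM.
  by apply: specM; [apply: spec_qint nd n%:Z | exact: (spec_theta nd NM)].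
by apply: spec_sum => k /andP[_ kN]; apply: spec_rhs_term nd NM _ _.
Qed.

End SpecializedSides.

Lemma ord5_eq (k l : nat) : (k < 5)%N -> (l < 5)%N ->
  ((inord k : 'I_5) == inord l) = (k == l).
Proof. by move=> k5 l5; rewrite -val_eqE /= !inordK. Qed.

(** * Genericity of the variables in a fraction field *)

Section FractionGenericity.

Variable F : fieldType.
Local Notation R := {mpoly F[5]}.
Local Notation tofrac := (@FracField.tofrac R).

Lemma tofrac_neq (v : 'I_5 -> F) (p r : R) : p.@[v] != r.@[v] -> tofrac p != tofrac r.
Proof. by rewrite tofrac_eq; apply: contra => /eqP->. Qed.

Lemma tofracX_neq0 i : tofrac 'X_i != 0.
Proof.
by rewrite -tofrac0; apply: (@tofrac_neq (fun=> 1)); rewrite mevalXU meval0 oner_neq0.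
Qed.

(** Evaluating at ['X_i = 0] and ['X_j = 1] kills the left-hand side but no power of [Q]. The two
    forms of [Q] are the variable q and its image under [cyc]. *)
Lemma tofracX_generic (Q : R) (i j : 'I_5) :
  i != j -> Q = 'X_j \/ (exists2 z : F, z != 0 & Q = z%:MP) ->
  q_generic (tofrac Q) (tofrac 'X_i).
Proof.
move=> ij hQ k l; rewrite -!tofracXn -tofracM.
apply: (@tofrac_neq (fun m => (m == j)%:R)).
rewrite mevalM !rmorphXn /= mevalXU (negPf ij) mul0r eq_sym expf_neq0 //.
by case: hQ => [->|[z z0 ->]]; rewrite ?mevalXU ?eqxx ?oner_neq0 ?mevalC.
Qed.

Lemma tofracX_sub i j : i != j -> tofrac 'X_i != tofrac 'X_j.
Proof.
move=> ij; apply: (@tofrac_neq (fun m => (m == j)%:R)).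
by rewrite !mevalXU eqxx (negPf ij) eq_sym oner_neq0.
Qed.

Lemma tofracX_mul i j : tofrac 'X_i * tofrac 'X_j != 1.
Proof.
rewrite -tofracM -tofrac1; apply: (@tofrac_neq (fun m => 0)).
by rewrite mevalM !mevalXU meval1 mulr0 eq_sym oner_neq0.
Qed.

End FractionGenericity.

Lemma q_exp_inj k l : q_ ^+ k = q_ ^+ l -> k = l.
Proof.
rewrite /q_ /toRF -!tofracXn => /eqP; rewrite tofrac_eq => /eqP/(congr1 (meval (fun=> 2%:R))).
by rewrite !rmorphXn /= mevalXU; apply: ieexprIn.
Qed.

Lemma q_neq0 : q_ != 0. Proof. exact: tofracX_neq0. Qed.

Lemma var_neq0 k : toRF 'X_(inord k) != 0. Proof. exact: tofracX_neq0. Qed.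

Lemma var_generic k : (0 < k < 5)%N -> q_generic q_ (toRF 'X_(inord k)).
Proof.
case/andP=> k0 k5; apply: (@tofracX_generic _ _ _ (inord 0)); last by left.
by rewrite ord5_eq // gtn_eqF.
Qed.

Definition lin_modulus n : seq MPol :=
  [:: 1 - ma * mq ^+ n; ma - mq ^+ n; mb - mq ^+ n].

Lemma lin_modulus_neq0 n p : p \in lin_modulus n -> p != 0.
Proof.
move=> hp; apply/eqP => /(congr1 (meval (fun m : 'I_5 => (m == inord 0)%:R : rat))).
move: hp; rewrite meval0 !inE => /or3P[]/eqP->;
  rewrite mevalB ?mevalM ?meval1 rmorphXn /= !mevalXU !ord5_eq //= expr1n => /eqP;
  by rewrite ?mul0r ?subr0 ?sub0r ?oppr_eq0 oner_eq0.
Qed.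

Lemma cycX z i :
  cyc z 'X_i = @FracField.tofrac {mpoly algC[5]} (if i == inord 0 then z%:MP else 'X_i).
Proof. by rewrite /cyc /= cyc_mapX. Qed.

Lemma cyc_order n (z : algC) : n.-primitive_root z ->
  @FracField.tofrac {mpoly algC[5]} z%:MP ^+ n = 1.
Proof.
by move=> prim_z; rewrite -tofracXn -rmorphXn /= (prim_expr_order prim_z) tofrac1.
Qed.

(** The product of the linear factors when q^n = 1, for [independent_modulus]. *)
Lemma prod_sub1_neq0 (K : fieldType) (x y : K) :
  x != 1 -> y != 1 -> (1 - x) * ((x - 1) * (y - 1)) != 0.
Proof. by move=> x1 y1; rewrite !mulf_neq0 ?subr_eq0 // eq_sym. Qed.

(** The last two linear factors at a = q^-n, with [x] = q^n and [y] = b. *)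
Lemma inv_sub_mul_neq0 (K : fieldType) (x y : K) :
  x != 0 -> x * x != 1 -> y - x != 0 -> (x^-1 - x) * (y - x) != 0.
Proof.
move=> x0 xx yx; rewrite mulf_neq0 // subr_eq0; apply: contra xx => /eqP e.
by rewrite -{1}e mulVf.
Qed.

(** * Assembling the four specializations *)

Section Congruence.

Variables (n M : nat).
Local Notation N := (n.+1)./2.
Hypotheses (n1 : (1 < n)%N) (oddn : odd n) (NM : (N <= M)%N) (Mn : (M < n)%N).

Definition sides_sub : RF := \sum_(0 <= k < M.+1) lhs_term q_ a_ b_ c_ d_ k
    - qint q_ n%:Z * Theta n * \sum_(0 <= k < N.+1) rhs_term q_ a_ b_ c_ d_ k.

Let qn0 : q_ ^+ n != 0. Proof. by rewrite expf_neq0 ?q_neq0. Qed.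

Lemma subst_aE v : [/\ subst (inord 1) v mq = q_, subst (inord 1) v ma = v,
  subst (inord 1) v mb = b_, subst (inord 1) v mc = c_ & subst (inord 1) v md = d_].
Proof. by split; rewrite substX ord5_eq. Qed.

Lemma subst_bE v : [/\ subst (inord 2) v mq = q_, subst (inord 2) v ma = a_,
  subst (inord 2) v mb = v, subst (inord 2) v mc = c_ & subst (inord 2) v md = d_].
Proof. by split; rewrite substX ord5_eq. Qed.

Lemma sides_sub_spec_a v : v * q_ ^+ n = 1 \/ v = q_ ^+ n ->
  spec (subst (inord 1) v) sides_sub 0.
Proof.
move=> hv; have [eq ea eb ec ed] := subst_aE v.
have [nd nD nE nF] : nondegenerate_top q_ v b_ c_ d_ n M.
  exact: (nondegenerate_top_a q_neq0 n1 oddn NM (var_neq0 3) (var_neq0 4)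
    (@var_generic 3 isT) (@var_generic 4 isT) (var_neq0 2) (@var_generic 2 isT)
    q_exp_inj hv).
apply: spec_sides_sub NM _ _; rewrite /= eq ea eb ec ed; first exact: nd.
exact: (sides_eq_a oddn NM nd nD nE nF hv).
Qed.

Lemma sides_sub_spec_b : spec (subst (inord 2) (q_ ^+ n)) sides_sub 0.
Proof.
have [eq ea eb ec ed] := subst_bE (q_ ^+ n).
have [nd nD nE nF] : nondegenerate_top q_ a_ (q_ ^+ n) c_ d_ n M.
  exact: (nondegenerate_top_b q_neq0 n1 oddn NM (var_neq0 3) (var_neq0 4)
    (@var_generic 3 isT) (@var_generic 4 isT) (var_neq0 1) (@var_generic 1 isT)
    q_exp_inj erefl).
apply: spec_sides_sub NM _ _; rewrite /= eq ea eb ec ed; first exact: nd.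
exact: (sides_eq_b oddn NM nd nD nE nF erefl).
Qed.

Lemma sides_sub_spec_cyc (z : algC) : n.-primitive_root z -> spec (cyc z) sides_sub 0.
Proof.
move=> prim_z; pose fr := @FracField.tofrac {mpoly algC[5]}.
have z0 : z != 0.
  apply: contra_eq_neq (prim_expr_order prim_z) => ->.
  by rewrite expr0n gtn_eqF 1?ltnW // eq_sym oner_neq0.
have fz : fr z%:MP ^+ n = 1 by apply: cyc_order.
have prim_fz : n.-primitive_root (fr z%:MP).
  by rewrite -(fmorph_primitive_root (fr \o @mpolyC 5 algC)) in prim_z.
have gen k : (0 < k < 5)%N -> q_generic (fr z%:MP) (fr 'X_(inord k)).
  case/andP=> k0 k5; apply: (@tofracX_generic _ _ _ (inord 0)); first by rewrite ord5_eq // gtn_eqF.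
  by right; exists z.
have [nd nD nE nF] : nondegenerate_top (fr z%:MP) (fr 'X_(inord 1)) (fr 'X_(inord 2))
    (fr 'X_(inord 3)) (fr 'X_(inord 4)) n M.
  have fz0 : fr z%:MP != 0 by rewrite tofrac_eq0 mpolyC_eq0.
  have nz k : fr 'X_(inord k) != 0 by apply: tofracX_neq0.
  have ab : fr 'X_(inord 1) != fr 'X_(inord 2) by apply: tofracX_sub; rewrite ord5_eq.
  have ab1 : fr 'X_(inord 1) * fr 'X_(inord 2) != 1 by apply: tofracX_mul.
  exact: (nondegenerate_top_root fz0 n1 oddn NM (nz 3) (nz 4) (gen 3 isT) (gen 4 isT)
    (nz 1) (nz 2) (gen 1 isT) (gen 2 isT) ab ab1 Mn prim_fz).
apply: spec_sides_sub NM _ _; rewrite /= !cycX !ord5_eq //=.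
(* The right-hand side vanishes through its factor [n]. *)
rewrite fz subrr !mul0r.
exact: (lhs_sum_root_of_unity n1 oddn NM nd nD nE nF fz).
Qed.

Let mdvd_opp (p : MPol) : mdvd p (- p). Proof. exact/mdvdN/mdvd_refl. Qed.

Lemma kernel_1_aq : has_kernel (subst (inord 1) (q_ ^+ n)^-1) (1 - ma * mq ^+ n).
Proof.
have [eq ea _ _ _] := subst_aE (q_ ^+ n)^-1.
(* Modulo 1 - a q^n, the relation for a is q^n a = 1, and the inverse of [s] = q^n is a itself. *)
apply: (@subst_kernel _ _ _ 1 (mq ^+ n) ma).
- by rewrite rmorph1 rmorphXn mulVf.
- by rewrite -[X in mdvd _ X]opprB; apply: mdvd_opp.
- by rewrite [mq ^+ n * _]mulrC -[X in mdvd _ X]opprB; apply: mdvd_opp.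
- by rewrite rmorphB rmorph1 rmorphM rmorphXn /= eq ea mulVf // subrr.
Qed.

Lemma kernel_a_q : has_kernel (subst (inord 1) (q_ ^+ n)) (ma - mq ^+ n).
Proof.
have [eq ea _ _ _] := subst_aE (q_ ^+ n).
apply: (@subst_kernel _ _ _ (mq ^+ n) 1 1).
- by rewrite rmorph1 rmorphXn mulr1.
- by rewrite mulr1; apply: mdvd_refl.
- by rewrite mulr1 subrr; apply: mdvd0.
- by rewrite rmorphB rmorphXn /= eq ea subrr.
Qed.

Lemma kernel_b_q : has_kernel (subst (inord 2) (q_ ^+ n)) (mb - mq ^+ n).
Proof.
have [eq _ eb _ _] := subst_bE (q_ ^+ n).
apply: (@subst_kernel _ _ _ (mq ^+ n) 1 1).
- by rewrite rmorph1 rmorphXn mulr1.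
- by rewrite mulr1; apply: mdvd_refl.
- by rewrite mulr1 subrr; apply: mdvd0.
- by rewrite rmorphB rmorphXn /= eq eb subrr.
Qed.

Let b_qn : b_ - q_ ^+ n != 0.
Proof. by have := @var_generic 2 isT 0 n; rewrite expr0 mulr1 subr_eq0. Qed.

(** Each factor is tested by applying the homomorphism whose kernel it generates to the product of
    the later ones. *)
Lemma independent_modulus : independent (PhiQ n :: lin_modulus n).
Proof.
split; last (split; last (split; last split=> //)).
- have [z prim_z] := C_prim_root_exists (ltnW n1).
  move/(cyc_kernel prim_z)/eqP; apply/negP; rewrite !big_cons big_nil mulr1.
  have cX k : (0 < k < 5)%N -> cyc z 'X_(inord k) != 1.
    case/andP=> k0 k5; rewrite cycX ord5_eq // gtn_eqF // -tofrac1.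
    apply: (@tofrac_neq _ (fun=> 0)).
    by rewrite mevalXU meval1 eq_sym oner_neq0.
  have cq : cyc z mq ^+ n = 1 by rewrite cycX eqxx; apply: cyc_order.
  rewrite !rmorphM !rmorphB rmorphM rmorph1 !rmorphXn /= cq mulr1.
  exact: (prod_sub1_neq0 (cX 1%N isT) (cX 2%N isT)).
- move/kernel_1_aq/eqP; apply/negP; rewrite !big_cons big_nil mulr1.
  have [eq ea eb _ _] := subst_aE (q_ ^+ n)^-1.
  rewrite rmorphM !rmorphB !rmorphXn /= eq ea eb.
  apply: (inv_sub_mul_neq0 qn0 _ b_qn); rewrite -exprD; apply/eqP.
  by move=> /(q_exp_inj (l := 0)); lia.
- move/kernel_a_q/eqP; apply/negP; rewrite !big_cons big_nil mulr1.
  have [eq ea eb _ _] := subst_aE (q_ ^+ n).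
  by rewrite rmorphB rmorphXn /= eq eb.
- by rewrite big_nil => /kernel_b_q/eqP; rewrite rmorph1 oner_eq0.
Qed.

Lemma sides_cong : cong_mod (\sum_(0 <= k < M.+1) lhs_term q_ a_ b_ c_ d_ k)
    (qint q_ n%:Z * Theta n * \sum_(0 <= k < N.+1) rhs_term q_ a_ b_ c_ d_ k)
    (\prod_(p <- PhiQ n :: lin_modulus n) p).
Proof.
have [z prim_z] := C_prim_root_exists (ltnW n1).
have lz p : p \in PhiQ n :: lin_modulus n -> mprime p /\ local_zero sides_sub p.
  rewrite inE => /orP[/eqP->|hp].
    split; first exact: has_kernel_prime (PhiQ_neq0 n) (cyc_kernel prim_z).
    exact: spec_local_zero (cyc_kernel prim_z) (sides_sub_spec_cyc prim_z).
  have p0 := lin_modulus_neq0 hp; move: hp p0; rewrite !inE => /or3P[]/eqP-> p0.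
  - split; first exact: has_kernel_prime p0 kernel_1_aq.
    exact: (spec_local_zero kernel_1_aq (sides_sub_spec_a (or_introl (mulVf qn0)))).
  - split; first exact: has_kernel_prime p0 kernel_a_q.
    by apply: spec_local_zero kernel_a_q (sides_sub_spec_a _); right.
  - split; first exact: has_kernel_prime p0 kernel_b_q.
    exact: spec_local_zero kernel_b_q sides_sub_spec_b.
apply: (cong_mod_prod _ lz independent_modulus).
(* The fraction representing the difference is taken from its local form at the cyclotomic
   factor. *)
have [_ [u [v [pv _ e]]]] := lz _ (mem_head _ _).
by exists u, v; split=> //; rewrite -toRF_eq0; apply: ndvd_toRF pv.
Qed.

End Congruence.

Unset Implicit Arguments.

Theorem theorem3p1 (n M : nat) :
  (1 < n)%N -> odd n -> (M = (n.+1)./2 \/ M = n.-1) ->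
  cong_mod
    (\sum_(0 <= k < M.+1)
        qint q_ ((4 * k)%:Z - 1)
        * (qpoch (a_ / q_) (q_ ^+ 2) k * qpoch (q_^-1 / a_) (q_ ^+ 2) k
           * qpoch (q_^-1 / b_) (q_ ^+ 2) k * qpoch (c_ / q_) (q_ ^+ 2) k
           * qpoch (d_ / q_) (q_ ^+ 2) k * qpoch q_^-1 (q_ ^+ 2) k)
        / (qpoch (q_ ^+ 2 / a_) (q_ ^+ 2) k * qpoch (a_ * q_ ^+ 2) (q_ ^+ 2) k
           * qpoch (b_ * q_ ^+ 2) (q_ ^+ 2) k * qpoch (q_ ^+ 2 / c_) (q_ ^+ 2) k
           * qpoch (q_ ^+ 2 / d_) (q_ ^+ 2) k * qpoch (q_ ^+ 2) (q_ ^+ 2) k)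
        * (b_ * q_ ^+ 7 / (c_ * d_)) ^+ k)
    (qint q_ n%:Z * Theta n *
     \sum_(0 <= k < ((n.+1)./2).+1)
        (qpoch (a_ / q_) (q_ ^+ 2) k * qpoch (q_^-1 / a_) (q_ ^+ 2) k
         * qpoch (q_^-1 / b_) (q_ ^+ 2) k * qpoch (q_ ^+ 3 / (c_ * d_)) (q_ ^+ 2) k)
        / (qpoch (q_ ^+ 2) (q_ ^+ 2) k * qpoch (q_^-2 / b_) (q_ ^+ 2) k
           * qpoch (q_ ^+ 2 / c_) (q_ ^+ 2) k * qpoch (q_ ^+ 2 / d_) (q_ ^+ 2) k)
        * q_ ^+ (2 * k))
    (PhiQ n * (1 - ma * mq ^+ n) * (ma - mq ^+ n) * (mb - mq ^+ n)).
Proof.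
move=> n1 oddn hM.
(* Both choices of [M] satisfy (n+1)/2 <= M < n: the lower bound keeps all terms that survive
   specialization, the upper one keeps (q^2;q^2)_M nonzero at a primitive n-th root of unity. *)
have NM : ((n.+1)./2 <= M)%N by case: hM => ->; lia.
have Mn : (M < n)%N.
  have nE : n.+1 = (n.+1)./2.*2 by rewrite -[LHS]odd_double_half /= oddn.
  by case: hM => ->; lia.
have -> : PhiQ n * (1 - ma * mq ^+ n) * (ma - mq ^+ n) * (mb - mq ^+ n)
    = \prod_(p <- PhiQ n :: lin_modulus n) p.
  by rewrite !big_cons big_nil mulr1 !mulrA.
exact: (sides_cong n1 oddn NM Mn).
Qed.
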